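(* Let $(\mathcal{X},d)$ be a compact metric space and $T:\mathcal{X}\to\mathcal{X}$ a continuous map. Then $$\limsup_{\epsilon\to0}\frac{\sup_{\mu\in\mathcal{M}_T(\mathcal{X})}R_\mu(\epsilon)}{|\log\epsilon|}=\limsup_{\epsilon\to0}\frac{\widetilde{S}(\mathcal{X},d,\epsilon)}{|\log\epsilon|}.$$ If moreover for every $\delta>0$ one has $\lim_{\epsilon\to0}\epsilon^{\delta}\log\#(\mathcal{X},d,\epsilon)=0$, where $\#(\mathcal{X},d,\epsilon)$ is the minimal number of $\epsilon$-balls needed to cover $\mathcal{X}$, then $$\overline{mdim}(\mathcal{X},d,T)=\limsup_{\epsilon\to0}\frac{\sup_{\mu\in\mathcal{M}_T(\mathcal{X})}R_\mu(\epsilon)}{|\log\epsilon|}.$$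
   Context: $\mathcal{M}_T(\mathcal{X})$ is the set of $T$-invariant Borel probability measures on $\mathcal{X}$. For $n\ge1$ let $d_n(x,y)=\max_{0\le k\le n-1}d(T^kx,T^ky)$ and $\widetilde{d}_n(x,y)=\frac1n\sum_{k=0}^{n-1}d(T^kx,T^ky)$. A set $E\subset\mathcal{X}$ is $(n,\epsilon)$-separated (respectively $(n,\epsilon)$-average separated) if $d_n(x,y)>\epsilon$ (respectively $\widetilde{d}_n(x,y)>\epsilon$) for all distinct $x,y\in E$. $N_d(n,\epsilon)$ and $\widetilde{N}_d(n,\epsilon)$ are the maximal cardinalities of an $(n,\epsilon)$-separated and an $(n,\epsilon)$-average separated subset of $\mathcal{X}$, respectively; $$S(\mathcal{X},d,\epsilon)=\limsup_{n\to\infty}\frac1n\log N_d(n,\epsilon),\quad \widetilde{S}(\mathcal{X},d,\epsilon)=\limsup_{n\to\infty}\frac1n\log\widetilde{N}_d(n,\epsilon),\quad \overline{mdim}(\mathcal{X},d,T)=\limsup_{\epsilon\to0}\frac{S(\mathcal{X},d,\epsilon)}{|\log\epsilon|}.$$ Rate distortion function: for $\mu\in\mathcal{M}_T(\mathcal{X})$, $n\ge 1$, $\epsilon>0$, a pair $(X,Y)$ satisfies condition $( * )_{n,\epsilon,\mu}$ if there is a probability space $(\Omega,\mathbb{P})$ such that $X:\Omega\to\mathcal{X}$ and $Y=(Y_0,\dots,Y_{n-1}):\Omega\to\mathcal{X}^n$ are measurable, $X_*\mathbb{P}=\mu$, and $\mathbb{E}\big(\frac1n\sum_{k=0}^{n-1}d(T^kX,Y_k)\big)\le\epsilon$.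 Then $R_\mu(\epsilon)=\inf\frac1n I(X,Y)$, the infimum being over all $n\ge1$ and all pairs $(X,Y)$ satisfying $( * )_{n,\epsilon,\mu}$. Here $I(X,Y)$ is the mutual information: for random variables $Z_1,Z_2$ with finite image, $I(Z_1,Z_2)=H(Z_1)+H(Z_2)-H(Z_1,Z_2)$ with $H$ the Shannon entropy, and in general $I(X,Y)$ is the supremum of $I(\alpha\circ X,\beta\circ Y)$ over measurable maps $\alpha,\beta$ with finite image. *)

(* Defs.v *)
From HB Require Import structures.
From mathcomp Require Import all_boot all_order all_algebra finmap.
From mathcomp Require Import all_classical all_reals all_analysis.

Set Implicit Arguments.
Unset Strict Implicit.
Unset Printing Implicit Defensive.

Import Order.TTheory GRing.Theory Num.Theory.
Import numFieldNormedType.Exports.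

Local Open Scope classical_set_scope.
Local Open Scope ring_scope.
Local Open Scope ereal_scope.

(* Measurable types are pointed in the library, so the spaces considered here
   are nonempty; the chosen point plays no other role. *)
#[short(type="pointedMetricType")]
HB.structure Definition PointedMetric (K : numDomainType) :=
  {M of Metric K M & Pointed M}.

Section DynamicalMetrics.
Variables (R : realType) (X : metricType R) (T : X -> X).

Definition dmax (n : nat) (x y : X) : R :=
  \big[Num.max/0%R]_(k < n) mdist (iter k T x) (iter k T y).

Definition davg (n : nat) (x y : X) : R :=
  (n%:R^-1 * \sum_(k < n) mdist (iter k T x) (iter k T y))%R.

Definition separated (rho : X -> X -> R) (eps : R) (E : set X) : Prop :=
  forall x y, E x -> E y -> x <> y -> (eps < rho x y)%R.

(* Supremum of the cardinalities of the finite separated sets: it is the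
   maximal cardinality of a separated set whenever the latter is finite. *)
Definition max_separated (rho : X -> X -> R) (eps : R) : \bar R :=
  ereal_sup [set (#|` E|%fset%:R)%:E |
             E in [set E : {fset X} | separated rho eps [set` E]]].

Definition sep_entropy (eps : R) : \bar R :=
  limn_esup (fun n => lne (max_separated (dmax n) eps) / (n%:R)%:E).

Definition avg_sep_entropy (eps : R) : \bar R :=
  limn_esup (fun n => lne (max_separated (davg n) eps) / (n%:R)%:E).

(* limsup as eps decreases to 0 of g(eps) / |log eps|. *)
Definition log_rate (g : R -> \bar R) : \bar R :=
  limf_esup (fun eps : R => g eps / (`|ln eps|%R)%:E) (0%R : R)^'+.

Definition upper_mdim : \bar R := log_rate sep_entropy.

End DynamicalMetrics.

Definition covering_number (R : realType) (X : metricType R) (eps : R) : \bar R :=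
  ereal_inf [set (#|` C|%fset%:R)%:E |
             C in [set C : {fset X} |
                   [set: X] `<=` \bigcup_(c in [set` C]) ball c eps]].

Definition tame_growth (R : realType) (X : metricType R) : Prop :=
  forall delta : R, (0 < delta)%R ->
    (eps `^ delta)%:E * lne (covering_number X eps) @[eps --> (0%R : R)^'+]
      --> (0 : \bar R).

Section MutualInformation.
Variables (R : realType) (d : measure_display) (Omega : measurableType d).
Variable P : probability Omega R.

Definition entropy (A : finType) (Z : Omega -> A) : R :=
  (- \sum_(a : A) (let p := fine (P (Z @^-1` [set a])) in p * ln p))%R.

Definition finite_mutual_info (A B : finType) (Z1 : Omega -> A)
    (Z2 : Omega -> B) : R :=
  (entropy Z1 + entropy Z2 - entropy (fun w => (Z1 w, Z2 w)))%R.

(* Measurability for the discrete sigma-algebra on the finite type A. *)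
Definition measurable_label (d' : measure_display) (S : measurableType d')
    (A : finType) (alpha : S -> A) : Prop :=
  forall B : set A, measurable (alpha @^-1` B).

Definition mutual_info (d1 d2 : measure_display) (S1 : measurableType d1)
    (S2 : measurableType d2) (X : Omega -> S1) (Y : Omega -> S2) : \bar R :=
  ereal_sup [set r | exists (A B : finType) (alpha : S1 -> A) (beta : S2 -> B),
    [/\ measurable_label alpha, measurable_label beta
      & r = (finite_mutual_info (alpha \o X) (beta \o Y))%:E]].

End MutualInformation.

Notation borel X := (g_sigma_algebraType (@open X)).

Section RateDistortion.
Variables (R : realType) (X : pointedMetricType R) (T : X -> X).

Definition invariant_measure (mu : probability (borel X) R) : Prop :=
  forall A : set (borel X), measurable A -> mu (T @^-1` A) = mu A.

(* The sigma-algebra on n.-tuple (borel X) is the product of the Borel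
   sigma-algebras. *)
Definition distortion_condition (n : nat) (eps : R)
    (mu : probability (borel X) R) (d : measure_display)
    (Omega : measurableType d) (P : probability Omega R)
    (Xi : Omega -> borel X) (Y : Omega -> n.-tuple (borel X)) : Prop :=
  [/\ measurable_fun [set: Omega] Xi,
      measurable_fun [set: Omega] Y,
      (forall A : set (borel X), measurable A -> P (Xi @^-1` A) = mu A)
    & 'E_P[fun w => (n%:R^-1 *
         \sum_(k < n) mdist (iter k T (Xi w)) (tnth (Y w) k : X))%R]
      <= eps%:E].

Definition rate_distortion (mu : probability (borel X) R) (eps : R) : \bar R :=
  ereal_inf [set r | exists (n : nat) (d : measure_display)
      (Omega : measurableType d) (P : probability Omega R)
      (Xi : Omega -> borel X) (Y : Omega -> n.-tuple (borel X)),
    [/\ (0 < n)%N, distortion_condition eps mu P Xi Y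
      & r = (n%:R^-1)%:E * mutual_info P Xi Y]].

Definition sup_rate_distortion (eps : R) : \bar R :=
  ereal_sup [set rate_distortion mu eps | mu in [set mu | invariant_measure mu]].

End RateDistortion.

(* Main.v *)
Require Import Defs.
From HB Require Import structures.
From mathcomp Require Import all_boot all_order all_algebra finmap.
From mathcomp Require Import all_classical all_reals all_analysis.
From mathcomp Require Import measurable_realfun ring lra zify.
Require Import Defs.

(** Both equalities compare limits superior of [g eps / |ln eps|], so that an
    inequality between [g eps] and [h (u eps)] is harmless as soon as
    [|ln (u eps)|] is at most [b |ln eps|] with [b] close to 1
    ([log_rate_le]).  Three inequalities at a fixed scale carry the proof.

    Rate distortion is at most averaged entropy.  A maximal separated set [F]
    for the averaged distance is also [eps]-dense, so replacing [x] by the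
    orbit of a nearby point of [F] is a code with distortion at most [eps].
    It takes [#|F|] values, hence carries at most [ln #|F|] of information,
    whatever the measure and whatever the length [n]
    ([rate_distortion_le_ln_card], [sup_rate_distortion_le]).

    Averaged entropy is almost at most rate distortion.  Given
    [s < avg_sep_entropy T eps] there are, for infinitely many [n], separated
    sets [E n] with at least [exp (s n)] points.  Averaging along the orbits of
    the points of [E n] and letting [n] go to infinity along an ultrafilter
    produces a [T]-invariant finitely additive probability on all subsets of
    [X]; regularizing it as in the proof of Riesz's theorem gives an invariant
    Borel probability [mu] which agrees with it on the sets whose boundary is
    [mu]-null ([exists_limit_measure]).  Let [(Xi, Y)] be a coupling with block
    length [m] and small distortion for [mu].  Quantizing with a partition of
    [X] into small sets with null boundary turns it into a finite stochastic
    matrix [q].  Feeding the orbit of a point of [E n] to [q] block by block,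
    with independent noise, gives a random word from which the point can be
    recovered with a probability controlled by Markov's inequality.  The
    relative entropy of the word with respect to independent blocks with the
    output law of the coupling is therefore large, by Fano's inequality
    ([block_coding_bound]); it is also a sum over the blocks of a function of
    their first label.  Averaging over the offset of the first block thus
    expresses everything through orbit averages of two functions of the label,
    and these converge: the relative entropies to the mutual information of
    the quantized coupling, the costs to its distortion
    ([coding_limit_bound], [exists_invariant_rate_ge]).

    Entropy is almost at most averaged entropy.  If the averaged distance of
    two points is at most [eps'], their orbits are farther than [L eps'] apart
    at no more than [n / L] times.  Recording these times, and a ball of radius
    [eps'] for each of them, shows that a [2 L eps']-separated set for the
    maximal distance is larger than a separated set for the averaged distance
    by a factor of at most [2^n N^(n/L)], with [N] the covering number at scale
    [eps'] ([card_dmax_separated_le], [sep_entropy_le_avg]).  Under tame growth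
    [L] can be chosen to be a negative power of [eps'] with arbitrarily small
    exponent while [(ln N) / L] stays bounded. *)

Set Implicit Arguments.
Unset Strict Implicit.
Unset Printing Implicit Defensive.

Import Order.TTheory GRing.Theory Num.Theory.
Import numFieldNormedType.Exports.

Local Open Scope classical_set_scope.
Local Open Scope ring_scope.

(** * Relative entropy *)

Section RelativeEntropy.
Variable R : realType.

Definition rel_entropy (Y : finType) (q r : Y -> R) : R :=
  \sum_y q y * ln (q y / r y).

(** The inequality of Donsker and Varadhan for the function equal to [ln M] on
    [S] and to 0 elsewhere, with [ln z <= z - 1] in place of the logarithm of
    the exponential moment.  The bound is linear in both laws, so it can be
    averaged over a family of disjoint sets [S]. *)
Lemma rel_entropy_ge_pred (Y : finType) (q r : Y -> R) (M : R) (S : pred Y) :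
  (forall y, 0 <= q y) -> (forall y, 0 <= r y) ->
  (forall y, 0 < q y -> 0 < r y) ->
  \sum_y q y = 1 -> \sum_y r y = 1 -> 1 <= M ->
  ln M * \sum_(y | S y) q y - M * \sum_(y | S y) r y <= rel_entropy q r.
Proof.
move=> q0 r0 qr q1 r1 M1.
pose w y : R := if S y then M else 1.
have w0 y : 0 < w y by rewrite /w; case: ifP => _ //; exact: lt_le_trans M1.
(* This is [ln z <= z - 1] at [z = r y * w y / q y]. *)
have pt y : q y * ln (w y) + q y - r y * w y <= q y * ln (q y / r y).
  have := q0 y; rewrite le_eqVlt => /orP[/eqP <-|qy].
    by rewrite !mul0r !add0r oppr_le0 mulr_ge0// ltW.
  have ry := qr y qy.
  have u0 : 0 < r y * w y / q y by rewrite divr_gt0// mulr_gt0.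
  have h : ln (r y * w y / q y) <= r y * w y / q y - 1.
    rewrite -{1}(subrK 1 (r y * w y / q y)) addrC; apply: le_ln1Dx.
    by rewrite ltrBrDr addNr.
  have e : ln (r y * w y / q y) = ln (w y) - ln (q y / r y).
    rewrite -ln_div ?posrE ?divr_gt0//; congr ln.
    by field; rewrite !gt_eqF.
  rewrite e in h; have := ler_wpM2l (q0 y) h.
  rewrite mulrBr mulrBr mulr1.
  rewrite (_ : q y * (r y * w y / q y) = r y * w y); last by field; rewrite gt_eqF.
  by lra.
have : \sum_y (q y * ln (w y) + q y - r y * w y) <= rel_entropy q r.
  by apply: ler_sum => y _.
apply: le_trans.
rewrite big_split big_split/= q1 sumrN.
have -> : \sum_y q y * ln (w y) = ln M * \sum_(y | S y) q y.
  rewrite mulr_sumr [RHS]big_mkcond/=; apply: eq_bigr => y _.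
  by rewrite /w; case: ifP => _; rewrite ?ln1 ?mulr0// mulrC.
have : \sum_y r y * w y <= 1 + M * \sum_(y | S y) r y.
  rewrite -r1 mulr_sumr [X in _ + X]big_mkcond/= -big_split/=; apply: ler_sum => y _.
  rewrite /w; case: ifP => _; first by rewrite mulrC lerDr.
  by rewrite mulr1 addr0.
lra.
Qed.

Lemma rel_entropy_ge0 (Y : finType) (q r : Y -> R) :
  (forall y, 0 <= q y) -> (forall y, 0 <= r y) ->
  (forall y, 0 < q y -> 0 < r y) ->
  \sum_y q y = 1 -> \sum_y r y = 1 -> 0 <= rel_entropy q r.
Proof.
move=> q0 r0 qr q1 r1.
have := rel_entropy_ge_pred pred0 q0 r0 qr q1 r1 (lexx 1).
by rewrite !big_pred0// !mulr0 subr0.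
Qed.

Lemma sum_prod_ffun (I B : finType) (q : I -> B -> R) :
  (forall i, \sum_b q i b = 1) ->
  \sum_(y : {ffun I -> B}) \prod_i q i (y i) = 1.
Proof. by move=> q1; rewrite -bigA_distr_bigA big1. Qed.

(** Under a product law, the mean of a function of one coordinate only depends
    on that coordinate's law. *)
Lemma expectation_prod_ffun (I B : finType) (q : I -> B -> R) (i0 : I)
    (h : B -> R) :
  (forall i, \sum_b q i b = 1) ->
  \sum_(y : {ffun I -> B}) (\prod_i q i (y i)) * h (y i0) =
  \sum_b q i0 b * h b.
Proof.
move=> q1.
pose F i b := q i b * (if i == i0 then h b else 1).
transitivity (\sum_(y : {ffun I -> B}) \prod_i F i (y i)).
  apply: eq_bigr => y _; rewrite big_split/=; congr (_ * _).
  by rewrite -big_mkcond/= big_pred1_eq.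
rewrite -bigA_distr_bigA (bigD1 i0)//= [X in _ * X]big1 ?mulr1.
  by apply: eq_bigr => b _; rewrite /F eqxx.
move=> i /negPf ii0; rewrite -[RHS](q1 i); apply: eq_bigr => b _.
by rewrite /F ii0 mulr1.
Qed.

Lemma ln_prod (I : finType) (u : I -> R) :
  (forall i, 0 < u i) -> ln (\prod_i u i) = \sum_i ln (u i).
Proof.
move=> u0.
suff [] : 0 < \prod_i u i /\ ln (\prod_i u i) = \sum_i ln (u i) by [].
elim/big_rec2 : _ => [|i y1 y2 _ [y0 e]]; first by rewrite ln1.
by rewrite mulr_gt0// lnM ?posrE// e.
Qed.

(** Relative entropy is additive over independent coordinates: the logarithm of
    the density is a sum of functions of one coordinate each. *)
Lemma rel_entropy_prod (I B : finType) (q r : I -> B -> R) :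
  (forall i b, 0 <= q i b) -> (forall i b, 0 < q i b -> 0 < r i b) ->
  (forall i, \sum_b q i b = 1) ->
  rel_entropy (fun y : {ffun I -> B} => \prod_i q i (y i))
              (fun y => \prod_i r i (y i)) =
  \sum_i rel_entropy (q i) (r i).
Proof.
move=> q0 qr q1; rewrite /rel_entropy.
transitivity (\sum_(y : {ffun I -> B}) \sum_i
    (\prod_i q i (y i)) * ln (q i (y i) / r i (y i))).
  apply: eq_bigr => y _; rewrite -mulr_sumr.
  have [->|Q0] := eqVneq (\prod_i q i (y i)) 0; first by rewrite !mul0r.
  have qi i : 0 < q i (y i).
    rewrite lt_neqAle q0 andbT eq_sym; apply: contra_neqN Q0 => /eqP qi.
    by rewrite (bigD1 i)//= qi mul0r.
  congr (_ * _); rewrite -prodf_div ln_prod// => i.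
  by rewrite divr_gt0// qr.
rewrite exchange_big/=; apply: eq_bigr => i _.
exact: (expectation_prod_ffun i (fun b => ln (q i b / r i b))).
Qed.

End RelativeEntropy.

(** * Mutual information of finite-valued maps *)

Section FiniteInformation.
Variables (R : realType) (A B : finType) (p : A -> B -> R).
Hypotheses (p0 : forall a b, 0 <= p a b) (p1 : \sum_a \sum_b p a b = 1).

Definition marginal1 (a : A) : R := \sum_b p a b.
Definition marginal2 (b : B) : R := \sum_a p a b.

(** On the rows of mass 0 the value is the second marginal, which makes every
    row a probability absolutely continuous with respect to that marginal. *)
Definition conditional (a : A) (b : B) : R :=
  if marginal1 a == 0 then marginal2 b else p a b / marginal1 a.

Let m1_ge a b : p a b <= marginal1 a.
Proof. by rewrite /marginal1 (bigD1 b)//= lerDl sumr_ge0. Qed.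

Let m2_ge a b : p a b <= marginal2 b.
Proof. by rewrite /marginal2 (bigD1 a)//= lerDl sumr_ge0. Qed.

Lemma marginal1_ge0 a : 0 <= marginal1 a. Proof. exact: sumr_ge0. Qed.
Lemma marginal2_ge0 b : 0 <= marginal2 b. Proof. exact: sumr_ge0. Qed.

Lemma sum_marginal1 : \sum_a marginal1 a = 1. Proof. by []. Qed.
Lemma sum_marginal2 : \sum_b marginal2 b = 1.
Proof. by rewrite exchange_big. Qed.

Lemma conditional_ge0 a b : 0 <= conditional a b.
Proof.
rewrite /conditional; case: ifP => _; first exact: marginal2_ge0.
by rewrite divr_ge0// marginal1_ge0.
Qed.

Lemma sum_conditional a : \sum_b conditional a b = 1.
Proof.
have [m0|m0] := eqVneq (marginal1 a) 0.
  by under eq_bigr do rewrite /conditional m0 eqxx; exact: sum_marginal2.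
under eq_bigr do rewrite /conditional (negPf m0).
by rewrite -mulr_suml mulfV.
Qed.

Lemma marginal1_conditional a b : marginal1 a * conditional a b = p a b.
Proof.
rewrite /conditional; case: ifPn => [/eqP m0|m0]; last by rewrite mulrC divfK.
by rewrite m0 mul0r; apply/eqP; rewrite eq_le p0 -m0 m1_ge.
Qed.

Lemma conditional_gt0 a b : 0 < conditional a b -> 0 < marginal2 b.
Proof.
rewrite /conditional; case: ifPn => [//|m0] h.
apply: lt_le_trans (m2_ge a b); rewrite lt_neqAle p0 andbT eq_sym.
by apply: contraTneq h => ->; rewrite mul0r ltxx.
Qed.

Definition mutual_information_sum : R :=
  \sum_a \sum_b p a b * ln (p a b / (marginal1 a * marginal2 b)).

Lemma mutual_information_entropies :
  - \sum_a marginal1 a * ln (marginal1 a) - \sum_b marginal2 b * ln (marginal2 b)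
  + \sum_a \sum_b p a b * ln (p a b) = mutual_information_sum.
Proof.
have e1 : \sum_a marginal1 a * ln (marginal1 a) =
    \sum_a \sum_b p a b * ln (marginal1 a).
  by apply: eq_bigr => a _; rewrite mulr_suml.
have e2 : \sum_b marginal2 b * ln (marginal2 b) =
    \sum_a \sum_b p a b * ln (marginal2 b).
  by rewrite exchange_big/=; apply: eq_bigr => b _; rewrite mulr_suml.
rewrite e1 e2 -!sumrN -!big_split/=; apply: eq_bigr => a _.
rewrite -!sumrN -!big_split/=; apply: eq_bigr => b _.
have [->|pn0] := eqVneq (p a b) 0; first by rewrite !mul0r oppr0 !addr0.
have pp : 0 < p a b by rewrite lt_neqAle p0 eq_sym pn0.
have m1p := lt_le_trans pp (m1_ge a b).
have m2p := lt_le_trans pp (m2_ge a b).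
rewrite ln_div ?posrE ?mulr_gt0// lnM ?posrE//; ring.
Qed.

(** This expresses the mutual information as an average over the input of a
    function of the input alone, the form that is linear in the input law when
    the channel and the reference output law are kept fixed. *)
Lemma mutual_information_rel_entropy :
  mutual_information_sum =
  \sum_a marginal1 a * rel_entropy (conditional a) marginal2.
Proof.
apply: eq_bigr => a _; rewrite mulr_sumr; apply: eq_bigr => b _.
rewrite mulrA marginal1_conditional.
have [->|pn0] := eqVneq (p a b) 0; first by rewrite !mul0r.
have pp : 0 < p a b by rewrite lt_neqAle p0 eq_sym pn0.
have m1p := lt_le_trans pp (m1_ge a b).
by rewrite /conditional gt_eqF// invfM mulrA.
Qed.

(** Subtracting [ln N] and using [ln z <= z - 1], the difference is at most the
    sum of [p a b ^ 2 / (marginal1 a * marginal2 b * N)] minus 1; bounding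
    [p a b / marginal1 a] by 1 leaves one term [1 / N] for each value of the
    second variable. *)
Lemma mutual_information_le_ln_card (N : nat) :
  (#|[pred b | marginal2 b != 0%R]| <= N)%N ->
  mutual_information_sum <= ln N%:R.
Proof.
move=> cN.
have N0 : 0 < N%:R :> R.
  rewrite ltr0n (leq_trans _ cN)//; apply/card_gt0P.
  apply: contrapT => /forallNP h.
  have := sum_marginal2; rewrite big1 => [/eqP|b _].
    by rewrite eq_sym oner_eq0.
  by apply/eqP; have := h b; rewrite inE => /negP; rewrite negbK.
have -> : ln N%:R = \sum_a \sum_b p a b * ln (N%:R : R).
  by under eq_bigr do rewrite -mulr_suml; rewrite -mulr_suml p1 mul1r.
rewrite -subr_le0 -sumrB.
apply: (@le_trans _ _ (\sum_a \sum_b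
  ((if marginal2 b == 0 then 0 else p a b / (marginal2 b * N%:R)) - p a b))).
  apply: ler_sum => a _; rewrite -sumrB; apply: ler_sum => b _.
  have [pz|pn0] := eqVneq (p a b) 0.
    by rewrite pz !mul0r subrr subr0; case: ifP.
  have pp : 0 < p a b by rewrite lt_neqAle p0 eq_sym pn0.
  have m1p := lt_le_trans pp (m1_ge a b).
  have m2p := lt_le_trans pp (m2_ge a b).
  rewrite gt_eqF// -mulrBr -ln_div ?posrE ?divr_gt0 ?mulr_gt0//.
  set u := _ / _ / N%:R.
  have u0 : 0 < u by rewrite !divr_gt0// mulr_gt0.
  have h : ln u <= u - 1.
    rewrite -{1}(subrK 1 u) addrC; apply: le_ln1Dx.
    by rewrite ltrBrDr addNr.
  apply: (le_trans (ler_wpM2l (p0 a b) h)).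
  have -> : u = (p a b / marginal1 a) * (marginal2 b * N%:R)^-1.
    by rewrite /u; field; rewrite !gt_eqF.
  rewrite mulrBr mulr1 lerD2r ler_wpM2l// ler_piMl//.
    by rewrite invr_ge0 mulr_ge0// marginal2_ge0.
  by rewrite ler_pdivrMr// mul1r.
under eq_bigr do rewrite big_split/= sumrN.
rewrite big_split/= sumrN p1 subr_le0 exchange_big/=.
apply: (@le_trans _ _ (\sum_(b | marginal2 b != 0) N%:R^-1)).
  rewrite [leRHS]big_mkcond/=; apply: ler_sum => b _.
  have [m0|m0] := eqVneq (marginal2 b) 0; first by rewrite big1.
  rewrite -mulr_suml -/(marginal2 b) invfM mulrA mulfV// mul1r//.
rewrite sumr_const -[_ *+ _]mulr_natl ler_pdivrMr// mul1r ler_nat.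
exact: cN.
Qed.

End FiniteInformation.

(** The integral of a nonnegative function is a supremum over simple functions
    below it, so monotonicity extends to distortions, functions of a pair of
    points whose measurability is left aside. *)
Lemma ge0_integral_mono (R : realType) (d : measure_display)
    (W : measurableType d) (mu : {measure set W -> \bar R}) (f g : W -> \bar R) :
  (forall w, (0 <= f w)%E) -> (forall w, (f w <= g w)%E) ->
  (\int[mu]_w f w <= \int[mu]_w g w)%E.
Proof.
move=> f0 fg; have g0 w : (0 <= g w)%E by exact: le_trans (fg w).
rewrite !ge0_integralTE//; apply: ereal_sup_le => _ [h hf <-]; exists h => //=.
by move=> w; exact: le_trans (fg w).
Qed.

Section LabelLaw.
Variables (R : realType) (d : measure_display) (W : measurableType d).
Variable P : probability W R.

Definition discrete_measurable (C : finType) (Z : W -> C) : Prop :=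
  forall c, measurable (Z @^-1` [set c]).

Definition label_mass (C : finType) (Z : W -> C) (c : C) : R :=
  fine (P (Z @^-1` [set c])).

Lemma label_mass_ge0 (C : finType) (Z : W -> C) c : 0 <= label_mass Z c.
Proof. by rewrite fine_ge0. Qed.

Lemma integral_label (C : finType) (Z : W -> C) (h : C -> R) :
  discrete_measurable Z -> (forall c, 0 <= h c) ->
  (\int[P]_w (h (Z w))%:E)%E = (\sum_c h c * label_mass Z c)%:E.
Proof.
move=> mZ h0.
transitivity (\int[P]_w (\sum_(c <- index_enum C)
    ((h c)%:E * (\1_(Z @^-1` [set c]) w)%:E)))%E.
  apply: eq_integral => w _.
  rewrite (bigD1_seq (Z w))/= ?mem_index_enum ?index_enum_uniq//.
  rewrite indicE mem_set// mule1 big1 ?adde0// => c cZ.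
  rewrite indicE memNset ?mule0// => /esym/eqP.
  by rewrite (negPf cZ).
rewrite ge0_integral_sum//; last 2 first.
- move=> c; apply: measurable_funeM; apply/measurable_EFinP.
  exact: measurable_indic.
- by move=> c w _; rewrite mule_ge0 ?lee_fin.
rewrite -sumEFin; apply: eq_bigr => c _.
rewrite ge0_integralZl_EFin//.
- by rewrite integral_indic// setIT /label_mass EFinM fineK// fin_num_measure.
- by apply/measurable_EFinP; exact: measurable_indic.
Qed.

Lemma label_mass_pred (C : finType) (Z : W -> C) (S : pred C) :
  discrete_measurable Z ->
  fine (P (Z @^-1` [set c | S c])) = \sum_(c | S c) label_mass Z c.
Proof.
move=> mZ.
have mS : measurable (Z @^-1` [set c | S c]).
  rewrite (_ : _ @^-1` _ = \bigcup_(c in [set c | S c]) (Z @^-1` [set c])).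
    by apply: fin_bigcup_measurable => //; exact: finite_finset.
  by apply/seteqP; split => w /=; [exists (Z w)|move=> [c Sc /= ->]].
have := integral_label (h := fun c => (S c)%:R) mZ (fun c => ler0n _ _).
rewrite (eq_integral (fun w => (\1_(Z @^-1` [set c | S c]) w)%:E)).
  rewrite integral_indic// setIT => ->; rewrite /= [RHS]big_mkcond/=.
  by apply: eq_bigr => c _; case: (S c); rewrite ?mul1r ?mul0r.
move=> w _; rewrite indicE; congr (_%:R%:E); congr nat_of_bool.
by apply/idP/idP => [h|/set_mem//]; exact/mem_set.
Qed.

Lemma sum_label_mass (C : finType) (Z : W -> C) : discrete_measurable Z ->
  \sum_c label_mass Z c = 1.
Proof.
move=> mZ; rewrite -(label_mass_pred xpredT mZ).
rewrite (_ : _ @^-1` _ = setT) ?probability_setT//.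
by apply/seteqP; split.
Qed.

Lemma discrete_measurable_comp (C D : finType) (Z : W -> C) (g : C -> D) :
  discrete_measurable Z -> discrete_measurable (g \o Z).
Proof.
move=> mZ b.
rewrite (_ : _ @^-1` _ = \bigcup_(c in [set c | g c = b]) (Z @^-1` [set c])).
  by apply: fin_bigcup_measurable => //; exact: finite_finset.
by apply/seteqP; split => w /=; [exists (Z w)|move=> [c /= <- <-]].
Qed.

Lemma discrete_measurable_pair (A B : finType) (Z1 : W -> A) (Z2 : W -> B) :
  discrete_measurable Z1 -> discrete_measurable Z2 ->
  discrete_measurable (fun w => (Z1 w, Z2 w)).
Proof.
move=> m1 m2 [a b].
rewrite (_ : _ @^-1` _ = Z1 @^-1` [set a] `&` Z2 @^-1` [set b]).
  exact: measurableI.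
by apply/seteqP; split => w /= [-> ->].
Qed.

Section Joint.
Variables (A B : finType) (Z1 : W -> A) (Z2 : W -> B).
Hypotheses (m1 : discrete_measurable Z1) (m2 : discrete_measurable Z2).

Definition joint_mass (a : A) (b : B) : R :=
  label_mass (fun w => (Z1 w, Z2 w)) (a, b).

Let m12 := discrete_measurable_pair m1 m2.

Lemma joint_mass_ge0 a b : 0 <= joint_mass a b.
Proof. exact: label_mass_ge0. Qed.

Lemma marginal1_joint a : marginal1 joint_mass a = label_mass Z1 a.
Proof.
have := label_mass_pred (fun c => c.1 == a) m12.
rewrite (_ : _ @^-1` _ = Z1 @^-1` [set a]); last first.
  by apply/seteqP; split => w /=; [move/eqP|move->].
rewrite -/(label_mass Z1 a) => ->.
rewrite /marginal1 (reindex (fun b => (a, b)))//=.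
  by apply: eq_bigl => b; rewrite eqxx.
by exists snd => [//|[a' b] /eqP/= ->].
Qed.

Lemma marginal2_joint b : marginal2 joint_mass b = label_mass Z2 b.
Proof.
have := label_mass_pred (fun c => c.2 == b) m12.
rewrite (_ : _ @^-1` _ = Z2 @^-1` [set b]); last first.
  by apply/seteqP; split => w /=; [move/eqP|move->].
rewrite -/(label_mass Z2 b) => ->.
rewrite /marginal2 (reindex (fun a => (a, b)))//=.
  by apply: eq_bigl => a; rewrite eqxx.
by exists fst => [//|[a b'] /eqP/= ->].
Qed.

Lemma sum_joint_mass : \sum_a \sum_b joint_mass a b = 1.
Proof. by rewrite -(sum_label_mass m12) pair_bigA/=; apply: eq_bigr => -[]. Qed.

Lemma finite_mutual_infoE :
  finite_mutual_info P Z1 Z2 = mutual_information_sum joint_mass.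
Proof.
rewrite -(mutual_information_entropies joint_mass_ge0).
rewrite /finite_mutual_info /entropy/= opprK; congr (_ - _ + _).
- by congr (- _); apply: eq_bigr => a _; rewrite marginal1_joint.
- by apply: eq_bigr => b _; rewrite marginal2_joint.
- by rewrite pair_bigA/=; apply: eq_bigr => -[].
Qed.

End Joint.

(** The second variable factors through [Z], so it takes at most [#|C|] values
    with positive probability. *)
Lemma finite_mutual_info_le_ln_card (A B C : finType) (Z1 : W -> A)
    (Z : W -> C) (g : C -> B) :
  discrete_measurable Z1 -> discrete_measurable Z ->
  finite_mutual_info P Z1 (g \o Z) <= ln #|C|%:R.
Proof.
move=> m1 mZ; have m2 := discrete_measurable_comp g mZ.
rewrite finite_mutual_infoE//; apply: mutual_information_le_ln_card.
- exact: joint_mass_ge0.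
- exact: sum_joint_mass.
apply: leq_trans (leq_image_card g predT); apply: subset_leq_card.
apply/fintype.subsetP => b; rewrite inE marginal2_joint// => b0.
apply/fintype.imageP; apply: contrapT => nb; move/eqP: b0; apply.
rewrite /label_mass (_ : _ @^-1` _ = set0) ?measure0//.
by apply/seteqP; split => // w /= gb; apply: nb; exists (Z w).
Qed.

Lemma label_expectation_le (C : finType) (Z : W -> C) (h : C -> R) (f : W -> R)
    (e : R) :
  discrete_measurable Z -> (forall c, 0 <= h c) -> (forall w, h (Z w) <= f w) ->
  ('E_P[f] <= e%:E)%E -> \sum_c h c * label_mass Z c <= e.
Proof.
move=> mZ h0 hf; rewrite unlock => Ef; rewrite -lee_fin -integral_label//.
by apply: le_trans Ef; apply: ge0_integral_mono => w; rewrite lee_fin.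
Qed.

End LabelLaw.

(** * Decoding a separated set from a memoryless block code *)

Lemma sum_blocks (R : nmodType) (F : nat -> R) (K m : nat) :
  \sum_(l < K) \sum_(k < m) F (l * m + k)%N = \sum_(s < K * m) F s.
Proof.
rewrite -(big_mkord xpredT (fun s => F s)) big_nat_mul big_mkord.
apply: eq_bigr => l _; rewrite -{2}(add0n (l * m)%N) mulSn big_addn addnK.
by rewrite big_mkord; apply: eq_bigr => k _; rewrite addnC.
Qed.

Lemma ler_sum_ord (R : numDomainType) (F : nat -> R) (a b : nat) :
  (forall t, 0 <= F t) -> (a <= b)%N -> \sum_(t < a) F t <= \sum_(t < b) F t.
Proof.
move=> F0 ab; rewrite -!(big_mkord xpredT F) (big_cat_nat _ ab)//=.
by rewrite lerDl sumr_ge0.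
Qed.

(** Letting the offset [j] run over a period makes the starting points of the
    blocks visit each time at most once. *)
Lemma sum_shifted_blocks_le (R : numDomainType) (F : nat -> R) (n m K : nat) :
  (forall t, 0 <= F t) -> (K.+1 * m <= n)%N ->
  \sum_(j < m) \sum_(l < K) F (l * m + j)%N <= \sum_(t < n) F t.
Proof.
move=> F0 Kn; rewrite exchange_big/= sum_blocks; apply: ler_sum_ord => //.
by apply: leq_trans Kn; rewrite leq_mul2r leqnSn orbT.
Qed.

(** The blocks starting at offset [j] miss fewer than [m] times at the beginning
    and the remaining ones, at most [2 m] in all, at the end. *)
Lemma sum_uncovered_le (R : numDomainType) (F : nat -> R) (D : R)
    (n m K j : nat) :
  (forall t, 0 <= F t <= D) -> (n <= K.+2 * m)%N -> (j < m)%N ->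
  \sum_(t < n) F t <=
  \sum_(l < K) \sum_(k < m) F (l * m + j + k)%N + D *+ (m * 2).
Proof.
move=> FD nK jm.
have F0 t : 0 <= F t by case/andP: (FD t).
have -> : \sum_(l < K) \sum_(k < m) F (l * m + j + k)%N =
    \sum_(s < K * m) F (j + s)%N.
  rewrite -(sum_blocks (fun s => F (j + s)%N)).
  by apply: eq_bigr => l _; apply: eq_bigr => k _; congr F; lia.
have /le_trans -> // : \sum_(t < n) F t <= \sum_(t < j + (K * m + (m * 2 - j))) F t.
  by apply: ler_sum_ord => //; lia.
rewrite -(big_mkord xpredT F).
rewrite (big_cat_nat (n := j))//= ?leq_addr// [X in _ + X](big_cat_nat (n := j + K * m))//=; [|lia..].
have -> : \sum_(j <= i < j + K * m) F i = \sum_(i < K * m) F (j + i)%N.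
  rewrite -{1}(add0n j) big_addn addKn big_mkord; by apply: eq_bigr => i _; rewrite addnC.
rewrite [leLHS]addrCA lerD2l.
have B a b : \sum_(a <= i < b) F i <= D *+ (b - a).
  rewrite -sumr_const_nat; apply: ler_sum => i _; by case/andP: (FD i).
apply: (le_trans (lerD (B _ _) (B _ _))).
by rewrite -mulrnDr (_ : _ + _ = m * 2)%N//; lia.
Qed.

Section BlockCoding.
Variables (R : realType) (X : metricType R).
Variables (E A B : finType) (n m : nat) (eps D tau : R).
Variables (x : E -> nat -> X) (lab : E -> nat -> A).
Variables (q : A -> B -> R) (r : B -> R) (y : B -> 'I_m -> X).

Let N : R := #|E|%:R.

Let g e t := \sum_b q (lab e t) b * \sum_(k < m) mdist (x e (t + k)%N) (y b k).

(** Fano's inequality for the random code described at the top of the file.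
    Here [x e] is the orbit of the point [e], [lab e t] the label of its
    position at time [t], and the channel [q] answers a label with a block of
    [m] reconstruction points [y b].  The hypothesis on [tau] says that twice
    [tau] is what remains of the separation [n eps] once the times not covered
    by the blocks are given up: two words within [tau] of the same sequence of
    reconstruction points come from the same [e]. *)
Lemma block_coding_bound :
  (0 < m)%N -> (2 * m <= n)%N -> (0 < #|E|)%N ->
  (forall u v : X, mdist u v <= D) ->
  (forall e e', e <> e' -> n%:R * eps < \sum_(t < n) mdist (x e t) (x e' t)) ->
  (forall a b, 0 <= q a b) -> (forall b, 0 <= r b) ->
  (forall a b, 0 < q a b -> 0 < r b) ->
  (forall a, \sum_b q a b = 1) -> \sum_b r b = 1 ->
  0 < tau -> n%:R * eps = tau *+ 2 + D *+ (m * 2) ->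
  m%:R * N * ln N - ln N / tau * (\sum_e \sum_(t < n) g e t) - m%:R * N
    <= \sum_e \sum_(t < n) rel_entropy (q (lab e t)) r.
Proof.
move=> m0 mn E0 dD sep q0 r0 qr q1 r1 tau0 etau.
(* One block less than [n / m], so that the same number fits for all offsets. *)
pose K := (n %/ m).-1.
have nm2 : (2 <= n %/ m)%N by rewrite leq_divRL.
have Kn : (K.+1 * m <= n)%N by rewrite prednK ?leq_trunc_div// ltnW.
have nK : (n <= K.+2 * m)%N.
  rewrite prednK; last exact: ltnW.
  by rewrite mulSn {1}(divn_eq n m) addnC leq_add2r ltnW// ltn_pmod.
have N1 : 1 <= N by rewrite ler1n.
have lnN0 : 0 <= ln N by exact: ln_ge0.
have g0 e t : 0 <= g e t.
  apply: sumr_ge0 => b _; rewrite mulr_ge0// sumr_ge0// => k _.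
  exact: mdist_ge0.
have h0 e t : 0 <= rel_entropy (q (lab e t)) r.
  by apply: rel_entropy_ge0 => // b; exact: qr.
pose c j e (w : {ffun 'I_K -> B}) : R :=
  \sum_(l < K) \sum_(k < m) mdist (x e (l * m + j + k)%N) (y (w l) k).
have c0 j e w : 0 <= c j e w.
  by do 2 (apply: sumr_ge0 => ? _); exact: mdist_ge0.
pose Q j e (w : {ffun 'I_K -> B}) : R :=
  \prod_(l < K) q (lab e (l * m + j)%N) (w l).
pose P (w : {ffun 'I_K -> B}) : R := \prod_(l < K) r (w l).
have Q0 j e w : 0 <= Q j e w by apply: prodr_ge0.
have P0 w : 0 <= P w by apply: prodr_ge0.
have Q1 j e : \sum_w Q j e w = 1.
  by apply: (sum_prod_ffun (q := fun l : 'I_K => q (lab e (l * m + j)%N))).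
have P1 : \sum_w P w = 1 by apply: (sum_prod_ffun (q := fun _ : 'I_K => r)).
have QP j e w : 0 < Q j e w -> 0 < P w.
  move=> Qw; apply: prodr_gt0 => l _; apply: (qr (lab e (l * m + j)%N)).
  rewrite lt_neqAle q0 andbT eq_sym; apply: contraTneq Qw => qw.
  by rewrite /Q (bigD1 l)//= qw mul0r ltxx.
pose S j e w := c j e w < tau.
(* The decoding sets [S j e] of distinct points are disjoint. *)
have disj j e e' w : (j < m)%N -> S j e w -> S j e' w -> e = e'.
  move=> jm Sw Sw'; apply: contrapT => /sep.
  apply/negP; rewrite -leNgt.
  apply: le_trans (sum_uncovered_le
     (F := fun t => mdist (x e t) (x e' t)) (D := D) _ nK jm) _.
    by move=> t /=; rewrite mdist_ge0 dD.
  rewrite etau lerD2r.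
  apply: (@le_trans _ _ (c j e w + c j e' w)); last first.
    by rewrite mulr2n ltW// ltrD.
  rewrite -big_split/=; apply: ler_sum => l _.
  rewrite -big_split/=; apply: ler_sum => k _.
  by rewrite [X in _ <= _ + X]metric_sym metric_triangle.
(* Hence a word drawn from [P], independently of [e], is decoded as [e] with
   probability [1 / N] on average: the term [m N] lost at the end. *)
have Pdisj j : (j < m)%N -> \sum_e \sum_(w | S j e w) P w <= 1.
  move=> jm; rewrite -P1.
  under eq_bigr do rewrite big_mkcond/=.
  rewrite exchange_big/=; apply: ler_sum => w _.
  rewrite -big_mkcond/=.
  have [e Se|noS] := pickP (fun e => S j e w).
    rewrite (big_pred1 e)// => e'; apply/idP/eqP => [Se'|->//].
    exact: disj Se' Se.
  by rewrite big_pred0.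
(* Decoding fails only if the distortion exceeds [tau]. *)
have markov j e : 1 - tau^-1 * \sum_(l < K) g e (l * m + j)%N
    <= \sum_(w | S j e w) Q j e w.
  have : \sum_w Q j e w * c j e w = \sum_(l < K) g e (l * m + j)%N.
    under eq_bigr do rewrite mulr_sumr.
    rewrite exchange_big/=; apply: eq_bigr => l _.
    exact: (expectation_prod_ffun
      (q := fun l : 'I_K => q (lab e (l * m + j)%N)) l
      (fun b => \sum_(k < m) mdist (x e (l * m + j + k)%N) (y b k))).
  move=> <-; rewrite -(Q1 j e) lerBlDr (bigID (S j e))/= lerD2l.
  rewrite mulr_sumr [leRHS](bigID (S j e))/=.
  apply: ler_wpDl.
    by apply: sumr_ge0 => w _; rewrite !mulr_ge0// invr_ge0 ltW.
  apply: ler_sum => w; rewrite /S -leNgt => tc.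
  by rewrite mulrCA ler_peMr// ler_pdivlMl// mulr1.
have step j : (j < m)%N ->
   N * ln N - ln N / tau * (\sum_e \sum_(l < K) g e (l * m + j)%N) - N <=
   \sum_e \sum_(l < K) rel_entropy (q (lab e (l * m + j)%N)) r.
  move=> jm.
  apply: (@le_trans _ _ (\sum_e rel_entropy (Q j e) P)); last first.
    apply: ler_sum => e _.
    by rewrite (rel_entropy_prod (q := fun l : 'I_K => q (lab e (l * m + j)%N))
      (r := fun _ : 'I_K => r))// => l b; exact: qr.
  apply: (@le_trans _ _ (\sum_e (ln N * \sum_(w | S j e w) Q j e w
      - N * \sum_(w | S j e w) P w))); last first.
    by apply: ler_sum => e _; apply: rel_entropy_ge_pred => //; exact: QP.
  rewrite big_split/= sumrN -!mulr_sumr; apply: lerB; last first.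
    by rewrite ler_piMr ?ler0n// Pdisj.
  have -> : N * ln N - ln N / tau * (\sum_e \sum_(l < K) g e (l * m + j)%N) =
     ln N * \sum_e (1 - tau^-1 * \sum_(l < K) g e (l * m + j)%N).
    rewrite big_split/= sumrN -mulr_sumr sumr_const -[1 *+ _]/N; ring.
  by apply: ler_wpM2l => //; apply: ler_sum => e _.
have : \sum_(j < m) (N * ln N
     - ln N / tau * (\sum_e \sum_(l < K) g e (l * m + j)%N) - N) <=
   \sum_(j < m) \sum_e \sum_(l < K) rel_entropy (q (lab e (l * m + j)%N)) r.
  by apply: ler_sum => j _; exact: step.
rewrite !big_split/= !sumrN -!mulr_sumr sumr_const card_ord.
rewrite sumr_const card_ord.
rewrite mulrnAr -mulrnAl -[N *+ m]mulr_natl => h.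
have gn : \sum_(j < m) \sum_e \sum_(l < K) g e (l * m + j)%N <=
    \sum_e \sum_(t < n) g e t.
  rewrite exchange_big/=; apply: ler_sum => e _.
  exact: sum_shifted_blocks_le.
have fn : \sum_(j < m) \sum_e \sum_(l < K)
      rel_entropy (q (lab e (l * m + j)%N)) r <=
    \sum_e \sum_(t < n) rel_entropy (q (lab e t)) r.
  rewrite exchange_big/=; apply: ler_sum => e _.
  exact: (sum_shifted_blocks_le (F := fun t => rel_entropy (q (lab e t)) r)).
apply: le_trans fn; apply: le_trans h; rewrite lerD2r lerD2l lerN2.
by apply: ler_wpM2l => //; rewrite divr_ge0// ltW.
Qed.

End BlockCoding.

(** * From finitely additive probabilities to Borel measures *)

Section FinitelyAdditive.
Variables (R : realType) (X : Type) (L : set X -> R).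

Definition finitely_additive_probability : Prop :=
  [/\ forall A, 0 <= L A,
      forall A B, A `&` B = set0 -> L (A `|` B) = L A + L B
    & L [set: X] = 1].

Hypothesis LP : finitely_additive_probability.

Lemma fap_ge0 A : 0 <= L A. Proof. by case: LP. Qed.

Lemma fapU A B : A `&` B = set0 -> L (A `|` B) = L A + L B.
Proof. by case: LP => _ + _; exact. Qed.

Lemma fap_setT : L setT = 1. Proof. by case: LP. Qed.

Lemma fap_set0 : L set0 = 0.
Proof.
by have := @fapU set0 set0 (setI0 _); rewrite setU0 => /eqP;
  rewrite -subr_eq subrr => /eqP.
Qed.

Lemma fap_le A B : A `<=` B -> L A <= L B.
Proof.
move=> AB; rewrite -(setDUK AB) fapU ?setDIK//.
by rewrite lerDl fap_ge0.
Qed.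

Lemma fapU_le A B : L (A `|` B) <= L A + L B.
Proof.
have -> : A `|` B = A `|` (B `\` A) by rewrite setDE setUIr setUv setIT.
rewrite fapU ?setDIK// lerD2l; apply: fap_le; exact: subDsetl.
Qed.

Lemma fap_setC A : L (~` A) = 1 - L A.
Proof. by rewrite -fap_setT -(setUv A) fapU ?setICr// addrC addKr. Qed.

End FinitelyAdditive.

(** The construction of a regular measure from a content: open sets are
    measured from inside by closed sets, arbitrary sets from outside by open
    sets.  Compactness is what turns finite additivity into countable
    subadditivity. *)
Section ContentMeasure.
Variables (R : realType) (X : ptopologicalType) (L : set X -> R).
Hypotheses (LP : finitely_additive_probability L)
  (hX : hausdorff_space X) (cX : compact [set: X]).

Local Open Scope ereal_scope.

Definition inner_content (U : set X) : \bar R :=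
  ereal_sup [set (L K)%:E | K in [set K | closed K /\ K `<=` U]].

Definition regular_outer (A : set X) : \bar R :=
  ereal_inf [set inner_content U | U in [set U | open U /\ A `<=` U]].

Let inner_le U V : U `<=` V -> inner_content U <= inner_content V.
Proof.
move=> UV; apply: ereal_sup_le => _ [K [cK KU] <-]; exists K => //.
by split => //; exact: subset_trans UV.
Qed.

Let inner_ge (K U : set X) : closed K -> K `<=` U -> (L K)%:E <= inner_content U.
Proof. by move=> cK KU; apply: ereal_sup_ubound; exists K. Qed.

Let inner_ge0 U : 0 <= inner_content U.
Proof.
rewrite -[0]/((0%R)%:E) -(fap_set0 LP); apply: inner_ge => //.
exact: closed0.
Qed.

Let inner_leL U : inner_content U <= (L U)%:E.
Proof. by apply: ge_ereal_sup => _ [K [_ KU] <-]; rewrite lee_fin fap_le. Qed.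

Let inner_fin U : inner_content U \is a fin_num.
Proof.
rewrite ge0_fin_numE//; apply: le_lt_trans (inner_leL U) _; exact: ltry.
Qed.

(* By normality a closed subset of [U `|` V] is the union of a closed subset of
   [U] and a closed subset of [V]. *)
Let innerU U V : open U -> open V ->
  inner_content (U `|` V) <= inner_content U + inner_content V.
Proof.
move=> oU oV; apply: ge_ereal_sup => _ [K [cK KUV] <-].
have cA : closed (K `\` U) by apply: closedI => //; exact: open_closedC.
have [C AC CV] : exists2 C, set_nbhs (K `\` U) C & closure C `<=` V.
  apply: (compact_normal hX cX cA) => x [Kx Ux].
  by apply: open_nbhs_nbhs; split => //; case: (KUV _ Kx).
pose K1 := K `\` C^°; pose K2 := K `&` closure C.
have K12 : K `<=` K1 `|` K2.
  move=> x Kx; have [Cx|Cx] := pselect (C^° x); last by left.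
  by right; split => //; apply: subset_closure; exact: interior_subset.
apply: (@le_trans _ _ ((L K1)%:E + (L K2)%:E)).
  by rewrite -EFinD lee_fin (le_trans (fap_le LP K12))// fapU_le.
apply: leeD; apply: inner_ge.
- by apply: closedI => //; apply: open_closedC; exact: open_interior.
- by move=> x [Kx Cx]; apply: contrapT => Ux; apply: Cx; exact: AC.
- by apply: closedI => //; exact: closed_closure.
- by move=> x [_ /CV].
Qed.

(* A closed subset of the union is compact, hence covered by finitely many of
   the [F n]. *)
Let inner_bigcup (F : (set X)^nat) : (forall n, open (F n)) ->
  inner_content (\bigcup_n F n) <= \sum_(n <oo) inner_content (F n).
Proof.
move=> oF; apply: ge_ereal_sup => _ [K [cK KF] <-].
have cptK : compact K by apply: subclosed_compact cX _.
move: (cptK); rewrite compact_cover => /(_ nat setT F (fun n _ => oF n) KF).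
move=> [D _ KD].
pose n := (\max_(i <- D) i).+1.
have KFn : K `<=` \big[setU/set0]_(i < n) F i.
  move=> x /KD[i /= iD Fx]; rewrite -bigcup_mkord; exists i => //=.
  by rewrite ltnS; apply: leq_bigmax_seq.
have fin k : open (\big[setU/set0]_(i < k) F i) /\
    inner_content (\big[setU/set0]_(i < k) F i) <=
    \sum_(0 <= i < k) inner_content (F i).
  elim: k => [|k [ok ih]].
    rewrite !big_ord0 big_geq//; split; first exact: open0.
    by rewrite (le_trans (inner_leL _))// (fap_set0 LP).
  rewrite big_ord_recr big_nat_recr//=; split; first exact: openU.
  by rewrite (le_trans (innerU _ _))// leeD2r.
apply: (le_trans (inner_ge cK KFn)); apply: (le_trans (fin n).2).
exact: nneseries_lim_ge.
Qed.

Let outer_le_inner (A U : set X) : open U -> A `<=` U ->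
  regular_outer A <= inner_content U.
Proof. by move=> oU AU; apply: ereal_inf_lbound; exists U. Qed.

Let outer_ge0 A : 0 <= regular_outer A.
Proof. by apply: le_ereal_inf_tmp => _ [U _ <-]. Qed.

Let outer_open U : open U -> regular_outer U = inner_content U.
Proof.
move=> oU; apply/eqP; rewrite eq_le outer_le_inner//=.
by apply: le_ereal_inf_tmp => _ [V [_ UV] <-]; exact: inner_le.
Qed.

Let outer_set0 : regular_outer set0 = 0.
Proof.
apply/eqP; rewrite eq_le outer_ge0 andbT outer_open; last exact: open0.
by rewrite (le_trans (inner_leL _))// (fap_set0 LP).
Qed.

Let outer_fin A : regular_outer A \is a fin_num.
Proof.
rewrite ge0_fin_numE//; apply: (@le_lt_trans _ _ (inner_content setT)).
  by apply: outer_le_inner => //; exact: openT.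
by rewrite -ge0_fin_numE.
Qed.

Let outer_subadditive A F : subset_sigma_subadditive regular_outer A F.
Proof.
move=> AF; apply/lee_addgt0Pr => e e0.
apply: le_trans (epsilon_trick xpredT (fun n => outer_ge0 (F n)) (ltW e0)).
have ex n : exists U, [/\ open U, F n `<=` U &
    inner_content U <= regular_outer (F n) + (e / (2 ^ n.+1)%:R)%:E].
  have en : (0 < e / (2 ^ n.+1)%:R :> R)%R by rewrite divr_gt0// ltr0n expn_gt0.
  have [_ [U [oU FU] <-] /ltW h] := lb_ereal_inf_adherent en (outer_fin (F n)).
  by exists U.
have [U hU] := choice ex.
apply: (@le_trans _ _ (inner_content (\bigcup_n U n))).
  apply: outer_le_inner; first by apply: bigcup_open => n _; case: (hU n).
  apply: (subset_trans AF) => x [n _ Fx]; exists n => //.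
  by case: (hU n) => _ + _; exact.
apply: (le_trans (inner_bigcup _)); first by move=> n; case: (hU n).
by apply: lee_nneseries => // n _; case: (hU n).
Qed.

HB.instance Definition _ := isSubsetOuterMeasure.Build R X regular_outer
  outer_set0 outer_ge0 outer_subadditive.

(* Choose [K1] almost filling [V `&` U], then [K2] almost filling [V `\` K1],
   which contains [V `\` U]; as they are disjoint, additivity on [K1 `|` K2]
   gives the inequality. *)
Let open_caratheodory U : open U -> regular_outer.-caratheodory U.
Proof.
move=> oG; apply: le_caratheodory_measurable => A.
apply: le_ereal_inf_tmp => _ [V [oV AV] <-].
apply: (@le_trans _ _ (inner_content (V `&` U) + regular_outer (V `&` ~` U))).
  apply: leeD; last by apply: le_outer_measure; exact: setSI.
  by apply: outer_le_inner; [exact: openI|exact: setSI].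
rewrite -leeBrDr//; apply: ge_ereal_sup => _ [K1 [cK1 K1VU] <-].
rewrite leeBrDr// addeC -leeBrDr//.
apply: (@le_trans _ _ (inner_content (V `&` ~` K1))).
  apply: outer_le_inner; first by apply: openI => //; exact: closed_openC.
  by move=> x [Vx Ux]; split => // /K1VU[].
apply: ge_ereal_sup => _ [K2 [cK2 K2V] <-].
rewrite leeBrDr// -EFinD -fapU//; last first.
  by rewrite -subset0 => x [/K2V[]].
apply: inner_ge; first exact: closedU.
by move=> x [/K2V[]|/K1VU[]].
Qed.

Definition content_measure : set (borel X) -> \bar R := regular_outer.

Let borel_caratheodory (A : set (borel X)) :
  measurable A -> regular_outer.-caratheodory A.
Proof.
move=> mA.
have : <<s @open X >> `<=` regular_outer.-cara.-measurable.
  apply: smallest_sub; first exact: sigma_algebra_measurable.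
  exact: open_caratheodory.
exact.
Qed.

Let content_measure0 : content_measure set0 = 0.
Proof. exact: outer_set0. Qed.

Let content_measure_ge0 A : 0 <= content_measure A.
Proof. exact: outer_ge0. Qed.

Let content_measure_sigma_additive : semi_sigma_additive content_measure.
Proof.
move=> F mF tF mUF.
apply: (@caratheodory_measure_sigma_additive R X regular_outer F) => //.
  by move=> n; exact: borel_caratheodory.
exact: borel_caratheodory.
Qed.

HB.instance Definition _ := isMeasure.Build _ _ _ content_measure
  content_measure0 content_measure_ge0 content_measure_sigma_additive.

Let content_measure_setT : content_measure setT = 1.
Proof.
rewrite /content_measure outer_open; last exact: openT.
apply/eqP; rewrite eq_le (le_trans (inner_leL _)) ?(fap_setT LP)//=.
rewrite -[1]/((1%R)%:E) -(fap_setT LP); apply: inner_ge => //.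
Qed.

HB.instance Definition _ := Measure_isProbability.Build _ _ _ content_measure
  content_measure_setT.

(** For closed sets the content is at most the measure; for open sets it is at
    least the measure.  Both follow from this formula. *)
Lemma exists_measure_inner :
  exists mu : probability (borel X) R,
    forall U : set X, open U -> mu U = inner_content U.
Proof. by exists content_measure; exact: outer_open. Qed.

End ContentMeasure.

(** * Borel probabilities on a metric space *)

Section MetricBasics.
Variables (R : realType) (X : metricType R).

Lemma mdist_continuous (x : X) : continuous (mdist x : X -> R).
Proof.
move=> y; apply/cvgrPdist_lt => e e0.
have : nbhs y (ball y e) by exact: nbhsx_ballx.
apply: filterS => z; rewrite ballEmdist/= => yz.
rewrite ltr_distlC -ltrBlDr.
have := metric_triangle x y z; have := metric_triangle x z y.
rewrite (metric_sym z y) => h1 h2; apply/andP; split; lra.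
Qed.

Lemma open_mdist_lt (x : X) (r : R) : open [set y | mdist x y < r].
Proof.
rewrite (_ : [set y | _] = (mdist x : X -> R) @^-1` [set t | t < r])//.
by apply: open_comp; [move=> ? _; exact: mdist_continuous|exact: open_lt].
Qed.

Lemma closed_mdist_le (x : X) (r : R) : closed [set y | mdist x y <= r].
Proof.
rewrite (_ : [set y | _] = (mdist x : X -> R) @^-1` [set t | t <= r])//.
by apply: closed_comp; [move=> ? _; exact: mdist_continuous|exact: closed_le].
Qed.

End MetricBasics.

Section BorelMetric.
Variables (R : realType) (X : pointedMetricType R).

Lemma open_borel (U : set X) : open U -> measurable (U : set (borel X)).
Proof. by move=> oU; exact: sub_sigma_algebra. Qed.

Lemma closed_borel (C : set X) : closed C -> measurable (C : set (borel X)).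
Proof.
move=> cC; rewrite -(setCK C); apply: measurableC; apply: open_borel.
exact: closed_openC.
Qed.

Lemma continuous_borel_measurable (f : X -> R) : continuous f ->
  measurable_fun [set: borel X] (f : borel X -> R).
Proof.
move=> /continuousP cf.
apply: (measurability _ (RGenOpens.measurableE R)) => _ [_ [a [b ->] <-]].
by rewrite setTI; apply: open_borel; apply: cf; exact: interval_open.
Qed.

Lemma continuous_borel_preimage (f : X -> X) (A : set (borel X)) :
  continuous f -> measurable A -> measurable (f @^-1` A : set (borel X)).
Proof.
move=> /continuousP cf mA.
have mf : measurable_fun [set: borel X] (f : borel X -> borel X).
  apply: (@measurability _ _ (borel X) (borel X) setT f (@open X)) => //.
  move=> _ [B oB <-].
  by rewrite setTI; apply: open_borel; exact: cf.
by rewrite -[X in measurable X]setTI; exact: mf.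
Qed.

Variable mu : probability (borel X) R.

(** Only countably many values of the distance to [x] have positive mass. *)
Lemma exists_null_sphere (x : X) (e : R) : 0 < e ->
  exists r, [/\ 0 < r, r < e & mu [set y | mdist x y = r] = 0%E].
Proof.
move=> e0.
have mf := continuous_borel_measurable (mdist_continuous (x := x)).
pose f : borel X -> R := mdist x.
pose hf := isMeasurableFun.Build _ _ _ _ f mf.
pose F : {mfun borel X >-> R} := HB.pack f hf.
have cB : countable [set r | 0 < pmf (P := mu) F r] by exact: pmf_gt0_countable.
have [r [r0 re nr]] : exists r, [/\ 0 < r, r < e & ~ 0 < pmf (P := mu) F r].
  apply: contrapT => /forallNP h.
  have sub : `]0, e[%classic `<=` [set r | 0 < pmf (P := mu) F r].
    move=> r /=; rewrite in_itv/= => /andP[r0 re].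
    by have := h r => /not_and3P[|//|/contrapT].
  have := countable_lebesgue_measure0 (sub_countable (subset_card_le sub) cB).
  rewrite lebesgue_measure_itv/= lte_fin e0 oppr0 adde0 => /eqP.
  by rewrite eqe gt_eqF.
exists r; split => //.
have : pmf (P := mu) F r = 0.
  by apply/eqP; rewrite eq_le pmf_ge0 andbT leNgt; exact/negP.
rewrite /pmf => h; rewrite -[0%E]/(0%R%:E) -h fineK// fin_num_measure//.
Qed.

End BorelMetric.

Section ContinuitySets.
Variables (R : realType) (X : pointedMetricType R).
Variable mu : probability (borel X) R.

(** These are the sets with [mu]-null boundary, presented by an open and a
    closed approximation so that they visibly form an algebra of sets. *)
Definition continuity_set (A : set X) : Prop :=
  exists V C : set X, [/\ open V, closed C, V `<=` A, A `<=` C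
    & mu (C `\` V) = 0%E].

Lemma continuity_set_measure (A V C : set X) :
  measurable (A : set (borel X)) -> open V -> closed C -> V `<=` A -> A `<=` C ->
  mu (C `\` V) = 0%E -> mu V = mu A /\ mu C = mu A.
Proof.
move=> mA oV cC VA AC mu0.
have mV := open_borel oV; have mC := closed_borel cC.
have eVC : mu C = mu V.
  rewrite -(setDUK (subset_trans VA AC)) measureU//; last first.
  - by rewrite setDIK.
  - exact: measurableD.
  by rewrite [X in (_ + X)%E](_ : _ = 0%E) ?adde0.
have h1 : (mu V <= mu A)%E by apply: le_measure => //; rewrite inE.
have h2 : (mu A <= mu C)%E by apply: le_measure => //; rewrite inE.
have e : mu V = mu A by apply/eqP; rewrite eq_le h1 -eVC.
by rewrite eVC.
Qed.

Lemma continuity_setC (A : set X) : continuity_set A -> continuity_set (~` A).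
Proof.
move=> [V [C [oV cC VA AC mu0]]]; exists (~` C), (~` V); split.
- exact: closed_openC.
- exact: open_closedC.
- exact: subsetC.
- exact: subsetC.
- by rewrite setDE setCK setIC -setDE.
Qed.

Lemma continuity_setI (A B : set X) : continuity_set A -> continuity_set B ->
  continuity_set (A `&` B).
Proof.
move=> [V [C [oV cC VA AC mu0]]] [V' [C' [oV' cC' VA' AC' mu0']]].
exists (V `&` V'), (C `&` C'); split.
- exact: openI.
- exact: closedI.
- exact: setISS.
- exact: setISS.
- have mD : measurable (C `\` V : set (borel X)).
    by apply: measurableD; [exact: closed_borel|exact: open_borel].
  have mD' : measurable (C' `\` V' : set (borel X)).
    by apply: measurableD; [exact: closed_borel|exact: open_borel].
  apply: (@subset_measure0 _ _ _ mu _ ((C `\` V) `|` (C' `\` V'))) => //.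
  + apply: measurableD; [apply: closed_borel; exact: closedI|].
    by apply: open_borel; exact: openI.
  + exact: measurableU.
  + move=> x [[Cx C'x] nV]; have [Vx|] := pselect (V x); last by left.
    by right; split => // V'x; exact: nV.
  + by apply/null_set_setU => //.
Qed.

Lemma continuity_set_setT : continuity_set [set: X].
Proof.
exists setT, setT; split; [exact: openT|exact: closedT|by []|by []|].
by rewrite setDv measure0.
Qed.

Lemma continuity_set_ball (x : X) (r : R) :
  mu [set y | mdist x y = r] = 0%E -> continuity_set [set y | mdist x y < r].
Proof.
move=> mu0; exists [set y | mdist x y < r], [set y | mdist x y <= r]; split => //.
- exact: open_mdist_lt.
- exact: closed_mdist_le.
- by move=> y /= /ltW.
- rewrite -mu0; congr (mu _); apply/seteqP; split => y /=.
    by move=> [h1 /negP]; rewrite -leNgt => h2; apply/eqP; rewrite eq_le h1.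
  by move=> ->; rewrite ltxx; split.
Qed.

End ContinuitySets.

Section MeasureDomination.
Variables (R : realType) (X : pointedMetricType R).

Lemma closed_bigcap_mdist (C : set X) : closed C ->
  C = \bigcap_k [set y | exists2 c, C c & mdist c y < k.+1%:R^-1].
Proof.
move=> cC; apply/seteqP; split => [y Cy k _|y Cy].
  by exists y => //; rewrite mdistxx invr_gt0.
apply: cC => V /nbhs_ballP[e /= e0 eV].
have [c Cc cy] := Cy (Num.truncn e^-1) I.
exists c; split => //; apply: eV; rewrite ballEmdist/= metric_sym.
apply: (lt_trans cy); rewrite -[ltRHS]invrK ltf_pV2 ?posrE ?invr_gt0//.
exact: truncnS_gt.
Qed.

Lemma open_mdist_nbhd (C : set X) (r : R) :
  open [set y | exists2 c, C c & mdist c y < r].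
Proof.
rewrite (_ : [set y | _] = \bigcup_(c in C) [set y | mdist c y < r]).
  by apply: bigcup_open => c _; exact: open_mdist_lt.
by apply/seteqP; split => y [c Cc cy]; exists c.
Qed.

Lemma probability_closed_lim (mu : probability (borel X) R) (C : set X) :
  closed C ->
  mu ([set y | exists2 c, C c & mdist c y < k.+1%:R^-1] : set (borel X))
    @[k --> \oo] --> mu C.
Proof.
move=> cC; rewrite {2}(closed_bigcap_mdist cC).
apply: (@nonincreasing_cvg_mu _ (borel X) R mu
   (fun k => [set y | exists2 c, C c & mdist c y < k.+1%:R^-1])).
- apply: le_lt_trans (probability_le1 _ _) (ltry _).
  by apply: open_borel; exact: open_mdist_nbhd.
- by move=> i; apply: open_borel; exact: open_mdist_nbhd.
- apply: bigcap_measurable => // i _.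
  by apply: open_borel; exact: open_mdist_nbhd.
- move=> i j ij; apply/subsetPset => y [c Cc cy]; exists c => //.
  by apply: (lt_le_trans cy); rewrite lef_pV2 ?posrE// ler_nat.
Qed.

Lemma probability_setCr (mu : probability (borel X) R) (A : set (borel X)) :
  measurable A -> mu A = (1 - mu (~` A))%E.
Proof.
move=> mA; rewrite -probability_setC ?setCK//; exact: measurableC.
Qed.

(** Complements turn domination on open sets into the reverse domination on
    closed sets; the other inequality for closed sets comes from their open
    neighbourhoods, which decrease to them. *)
Lemma probability_eq_of_le_open (mu nu : probability (borel X) R) :
  (forall U : set X, open U -> (mu U <= nu U)%E) ->
  forall A : set (borel X), measurable A -> mu A = nu A.
Proof.
move=> le_o.
have eq_c (C : set X) : closed C -> mu C = nu C.
  move=> cC; apply/eqP; rewrite eq_le; apply/andP; split; last first.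
    have mC := closed_borel cC.
    rewrite (probability_setCr mu mC) (probability_setCr nu mC) leeB//; apply: le_o; exact: closed_openC.
  apply: (lee_cvg_to (probability_closed_lim (mu := mu) cC)
    (probability_closed_lim (mu := nu) cC)).
  by apply: nearW => k; apply: le_o; exact: open_mdist_nbhd.
move=> A mA.
apply: (@measure_unique _ R (borel X) (@open X) (fun=> setT)) => //.
- by move=> U V oU oV; exact: openI.
- by move=> _; exact: openT.
- by rewrite bigcup_const.
- move=> U oU.
  have mU := open_borel oU.
  transitivity (1 - mu (~` U))%E; first exact: probability_setCr.
  transitivity (1 - nu (~` U))%E; last by apply/esym; exact: probability_setCr.
  by congr (_ - _)%E; apply: eq_c; exact: open_closedC.
- by move=> _; apply: le_lt_trans (probability_le1 mu measurableT) (ltry _).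
Qed.

End MeasureDomination.

(** * Invariant measures as limits of orbit averages *)

(** A cluster point in the compact segment is a limit, because an ultrafilter
    contains the preimage of a neighbourhood or the preimage of its
    complement. *)
Lemma ultra_bounded_cvg (R : realType) (U : set_system nat) (u : nat -> R)
    (a b : R) : UltraFilter U -> (forall n, a <= u n <= b) -> cvg (u @ U).
Proof.
move=> UU ub.
have : (u @ U) `[a, b]%classic.
  by apply: (@filterE _ U) => n; rewrite /= in_itv/=; exact: ub.
move=> /(segment_compact (a := a) (b := b) (F := u @ U)) [l [_ cl]].
apply/cvg_ex; exists l => V Vl /=.
have [//|nV] := in_ultra_setVsetC (u @^-1` V) UU.
have : (u @ U) (~` V) by [].
by move=> /cl /(_ Vl) [x [nVx /nVx]].
Qed.

Section InvariantMeasure.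
Variables (R : realType) (X : pointedMetricType R) (T : X -> X).
Variables (U : set_system nat) (E : nat -> {fset X}).
Hypotheses (UU : UltraFilter U) (Uoo : forall k, U [set n | (k <= n)%N]).
Hypothesis E0 : forall n, (0 < #|` E n|)%N.

Definition orbit_average (n : nat) (f : X -> R) : R :=
  (n%:R * #|` E n|%:R)^-1 * \sum_(e <- E n) \sum_(t < n) f (iter t T e).

(** A limit along an ultrafilter exists for every subset, so the limit is defined
    and additive on all subsets at once. *)
Definition limit_content (A : set X) : R :=
  lim (orbit_average n (\1_A) @[n --> U]).

Lemma orbit_average_cst (n : nat) (c : R) : (0 < n)%N ->
  orbit_average n (fun=> c) = c.
Proof.
move=> n0; rewrite /orbit_average.
under eq_bigr do rewrite sumr_const card_ord.
rewrite big_const_seq count_predT iter_addr_0 -mulrnA -[c *+ _]mulr_natl natrM.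
by rewrite mulKf// mulf_neq0// pnatr_eq0 -lt0n.
Qed.

Lemma orbit_averageD n f g : orbit_average n (fun x => f x + g x) =
  orbit_average n f + orbit_average n g.
Proof.
rewrite /orbit_average -mulrDr -big_split/=; congr (_ * _).
by apply: eq_bigr => e _; rewrite -big_split.
Qed.

Lemma orbit_average_le n f g : (forall x, f x <= g x) ->
  orbit_average n f <= orbit_average n g.
Proof.
move=> fg; apply: ler_wpM2l; first by rewrite invr_ge0 mulr_ge0.
by do 2 (apply: ler_sum => ? _).
Qed.

Lemma orbit_average_indic_itv n A : 0 <= orbit_average n (\1_A) <= 1.
Proof.
apply/andP; split.
  rewrite mulr_ge0 ?invr_ge0 ?mulr_ge0//.
  by do 2 (apply: sumr_ge0 => ? _).
have [->|n0] := posnP n; first by rewrite /orbit_average mul0r invr0 mul0r.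
rewrite -[leRHS](orbit_average_cst 1 n0); apply: orbit_average_le => x.
by rewrite indicE lern1 leq_b1.
Qed.

Lemma orbit_average_cvg A :
  orbit_average n (\1_A) @[n --> U] --> limit_content A.
Proof.
apply: ultra_bounded_cvg => n; exact: orbit_average_indic_itv.
Qed.

Lemma limit_content_fap : finitely_additive_probability limit_content.
Proof.
split=> [A|A B AB|].
- apply: limr_ge; first exact: orbit_average_cvg.
  by apply: nearW => n; case/andP: (orbit_average_indic_itv n A).
- apply/cvg_lim => //.
  rewrite (_ : (fun _ => _) = (fun n => orbit_average n (\1_A) + orbit_average n (\1_B))).
    by apply: cvgD; exact: orbit_average_cvg.
  apply/funext => n; rewrite -orbit_averageD; congr orbit_average.
  apply/funext => x; rewrite !indicE in_setU.
  have [xA|] := boolP (x \in A); have [xB|] := boolP (x \in B);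
    rewrite ?addr0 ?add0r//.
  have ABx : (A `&` B) x by split; exact/set_mem.
  by rewrite AB in ABx.
- apply/cvg_lim => //; apply: cvg_near_cst.
  apply: filterS (Uoo 1) => n n0.
  by rewrite (_ : \1__ = fun=> 1) ?orbit_average_cst// indicT.
Qed.

(** Shifting the time by one changes an orbit average by its two end terms,
    that is by at most [1 / n]. *)
Lemma limit_content_preimage A :
  limit_content (T @^-1` A) = limit_content A.
Proof.
have dif : orbit_average n (\1_(T @^-1` A)) - orbit_average n (\1_A)
    @[n --> U] --> (0 : R).
  apply/cvgrPdist_le => e e0.
  apply: filterS (Uoo (Num.truncn e^-1).+1) => n /= en.
  have n0 : (0 < n)%N by exact: leq_ltn_trans en.
  rewrite sub0r normrN /orbit_average -mulrBr -sumrB.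
  under eq_bigr => x _.
    rewrite -sumrB (eq_bigr (fun t : 'I_n => \1_A (iter t.+1 T x) - \1_A (iter t T x) : R)); last by [].
    rewrite -(big_mkord xpredT (fun t => \1_A (iter t.+1 T x) - \1_A (iter t T x) : R)) telescope_sumr//.
    over.
  rewrite normrM ger0_norm ?invr_ge0 ?mulr_ge0//.
  apply: (@le_trans _ _ ((n%:R * #|` E n|%:R)^-1 * #|` E n|%:R)).
    apply: ler_wpM2l; first by rewrite invr_ge0 mulr_ge0.
    apply: le_trans (ler_norm_sum _ _ _) _.
    rewrite -[leRHS]mulr1 mulr_natl -iter_addr_0 -(count_predT (E n)) -big_const_seq.
    apply: ler_sum => x _ /=; rewrite !indicE.
    by do 2 case: (_ \in _); rewrite ?subrr ?subr0 ?sub0r ?normrN ?normr1 ?normr0.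
  rewrite invfM -mulrA mulVf ?mulr1 ?pnatr_eq0 -?lt0n ?E0//.
  rewrite -[leRHS]invrK lef_pV2 ?posrE ?invr_gt0 ?ltr0n//.
  by apply/ltW; apply: lt_le_trans (truncnS_gt _) _; rewrite ler_nat.
apply/eqP; rewrite -subr_eq0; apply/eqP.
apply: (cvg_unique _ _ dif) => //.
by apply: cvgB; exact: orbit_average_cvg.
Qed.

End InvariantMeasure.

Section LimitMeasure.
Variables (R : realType) (X : pointedMetricType R).

Lemma exists_measure_metric (L : set X -> R) :
  compact [set: X] -> finitely_additive_probability L ->
  exists mu : probability (borel X) R,
    forall U : set X, open U ->
      mu U = ereal_sup [set (L K)%:E | K in [set K | closed K /\ K `<=` U]].
Proof. by move=> cX LP; exact: (exists_measure_inner LP (@metric_hausdorff R X) cX). Qed.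

(** Invariance of [mu] is inherited from [L]: for [U] open, [mu U] is the
    supremum of [L K = L (T @^-1` K) <= mu (T @^-1` K)] over closed [K] in [U],
    so [mu] is dominated on open sets by its image under [T]. *)
Lemma exists_limit_measure (T : X -> X) (L : set X -> R) :
  compact [set: X] -> continuous T -> finitely_additive_probability L ->
  (forall A, L (T @^-1` A) = L A) ->
  exists2 mu : probability (borel X) R, invariant_measure T mu &
    forall A : set (borel X), measurable A -> continuity_set mu A ->
      mu A = (L A)%:E.
Proof.
move=> cX cT LP LT.
have [mu muE] := exists_measure_metric cX LP.
have mu_open (U : set X) : open U -> (mu U <= (L U)%:E)%E.
  move=> oU; rewrite muE//; apply: ge_ereal_sup => _ [K [_ KU] <-].
  by rewrite lee_fin fap_le.
have mu_closed (C : set X) : closed C -> ((L C)%:E <= mu C)%E.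
  move=> cC; rewrite (probability_setCr _ (closed_borel cC)).
  rewrite leeBrDr ?fin_num_measure//; last first.
    by apply: measurableC; exact: closed_borel.
  apply: (@le_trans _ _ ((L C)%:E + (L (~` C))%:E)%E).
    by rewrite leeD2l// mu_open//; exact: closed_openC.
  by rewrite -EFinD lee_fin (fap_setC LP) addrC subrK.
exists mu.
  have mT : measurable_fun [set: borel X] (T : borel X -> borel X).
    move=> _ A mA; rewrite setTI; exact: continuous_borel_preimage.
  pose hT := isMeasurableFun.Build _ _ _ _ (T : borel X -> borel X) mT.
  pose F : {mfun borel X >-> borel X} := HB.pack (T : borel X -> borel X) hT.
  pose nu : probability (borel X) R := distribution mu F.
  move=> A mA; apply/esym.
  apply: (@probability_eq_of_le_open _ _ mu nu) => // U oU.
  rewrite muE//; apply: ge_ereal_sup => _ [K [cK KU] <-].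
  rewrite -LT; apply: (@le_trans _ _ (mu (T @^-1` K))).
    apply: mu_closed; apply: closed_comp => // x _; exact: cT.
  apply: le_measure; rewrite ?inE.
  - by apply: continuous_borel_preimage => //; exact: closed_borel.
  - by apply: continuous_borel_preimage => //; exact: open_borel.
  - by move=> x /KU.
move=> A mA [V [C [oV cC VA AC mu0]]].
have [eV eC] := continuity_set_measure mA oV cC VA AC mu0.
apply/eqP; rewrite eq_le; apply/andP; split.
  by rewrite -eV (le_trans (mu_open _ oV))// lee_fin fap_le.
by rewrite -eC (le_trans _ (mu_closed _ cC))// lee_fin fap_le.
Qed.

End LimitMeasure.

(** * Cardinality of separated sets *)

Section MaxSeparated.
Variables (R : realType) (X : metricType R).
Implicit Types (rho : X -> X -> R) (eps : R).

Lemma max_separated_le rho eps (c : R) :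
  (forall E : {fset X}, (0 < #|` E|)%N -> separated rho eps [set` E] ->
     #|` E|%:R <= c) -> 0 <= c -> (max_separated rho eps <= c%:E)%E.
Proof.
move=> h c0; apply: ge_ereal_sup => _ [E sE <-]; rewrite lee_fin.
by have [->|E0] := posnP #|` E|; [|exact: h].
Qed.

Lemma max_separated_ge rho eps (E : {fset X}) :
  separated rho eps [set` E] -> ((#|` E|%:R)%:E <= max_separated rho eps)%E.
Proof. by move=> sE; apply: ereal_sup_ubound; exists E. Qed.

Lemma max_separated_ge0 rho eps : (0 <= max_separated rho eps)%E.
Proof.
have := @max_separated_ge rho eps fset0; rewrite cardfs0; apply.
by move=> x y; rewrite /= inE.
Qed.

Lemma lne_max_separated_le rho eps (a : R) :
  (forall E : {fset X}, (0 < #|` E|)%N -> separated rho eps [set` E] ->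
     ln #|` E|%:R <= a) -> (lne (max_separated rho eps) <= a%:E)%E.
Proof.
move=> h; rewrite -[leRHS](_ : lne (expR a)%:E = _); last first.
  by rewrite lne_EFin ?expR_gt0// expRK.
rewrite lee_lne ?in_itv/= ?leey ?max_separated_ge0 ?lee_fin ?expR_ge0//.
apply: max_separated_le; last exact: expR_ge0.
move=> E E0 sE; rewrite -[leLHS]lnK ?posrE ?ltr0n//.
by rewrite ler_expR h.
Qed.

End MaxSeparated.

Section MaximalSeparated.
Variables (R : realType) (X : pointedMetricType R).

(** A separated set of maximal cardinality is dense at the same scale, as any
    point far from it could be added. *)
Lemma exists_maximal_separated (rho : X -> X -> R) (eps : R) :
  (forall x y, rho x y = rho y x) -> (forall x, rho x x <= eps) ->
  (max_separated rho eps < +oo)%E ->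
  exists F : {fset X}, [/\ (0 < #|` F|)%N, separated rho eps [set` F] &
    forall x, exists2 c, c \in F & rho x c <= eps].
Proof.
move=> rhoC rho_refl fin.
have [M hM] : exists M : R, max_separated rho eps = M%:E.
  have := max_separated_ge0 rho eps; move: fin.
  by case: (max_separated rho eps) => [M _ _|//|//]; exists M.
pose P k := `[< exists2 F : {fset X}, separated rho eps [set` F] & #|` F| = k >].
have exP : exists k, P k.
  exists 0%N; apply/asboolP; exists fset0; last by rewrite cardfs0.
  by move=> x y; rewrite /= inE.
have bP k : P k -> (k <= Num.truncn M)%N.
  move=> /asboolP[F sF <-]; rewrite truncn_ge_nat; last first.
    by have := max_separated_ge0 rho eps; rewrite hM lee_fin.
  by have := max_separated_ge sF; rewrite hM lee_fin.
case: (ex_maxnP exP bP) => k /asboolP[F sF kF] kmax.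
have cov x : exists2 c, c \in F & rho x c <= eps.
  have [xF|xF] := boolP (x \in F); first by exists x.
  apply: contrapT => no.
  have sx c : c \in F -> eps < rho x c.
    by move=> cF; rewrite ltNge; apply/negP => h; apply: no; exists c.
  have : P (#|` (x |` F)%fset|).
    apply/asboolP; exists (x |` F)%fset => // a b /=.
    rewrite !inE => /orP[/eqP ->|aF] /orP[/eqP ->|bF] ab //.
    - exact: sx.
    - by rewrite rhoC; exact: sx.
    - exact: sF.
  by move/kmax; rewrite cardfsU1 xF kF add1n ltnn.
exists F; split => //.
have [c cF _] := cov point; rewrite cardfs_gt0; apply/fset0Pn; by exists c.
Qed.

End MaximalSeparated.

(** * Upper bound for the rate distortion function *)

Section Atoms.
Variables (X : Type) (I : finType) (U : I -> set X).

(** Recording all the members that contain [x], rather than one of them, makes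
    the classes the atoms of the algebra of sets generated by the family. *)
Definition atom_label (x : X) : {set I} := finset (fun i => `[< U i x >]).

Lemma atom_preimage (s : {set I}) : atom_label @^-1` [set s] =
  \big[setI/setT]_i (if i \in s then U i else ~` U i).
Proof.
apply/seteqP; split => x /=.
  move=> <-; rewrite -bigcap_seq => i _ /=.
  by rewrite inE; case: asboolP.
rewrite -bigcap_seq => h; apply/setP => i; have := h i (mem_index_enum i).
rewrite inE; case: ifP => /= _ Ui; first exact/asboolP.
exact/asboolP.
Qed.

Lemma atom_class (K : set X -> Prop) : K setT -> (forall A, K A -> K (~` A)) ->
  (forall A B, K A -> K B -> K (A `&` B)) -> (forall i, K (U i)) ->
  forall s, K (atom_label @^-1` [set s]).
Proof.
move=> KT KC KI KU s; rewrite atom_preimage; elim/big_ind : _ => // i _.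
by case: ifP => _ //; exact: KC.
Qed.

End Atoms.

Section RateUpperBound.
Variables (R : realType) (X : pointedMetricType R) (T : X -> X).
Hypothesis cT : continuous T.

Lemma iter_continuous (k : nat) : continuous (iter k T).
Proof.
elim: k => [|k ih] x; first exact: cvg_id.
by apply: (@continuous_comp _ _ _ (iter k T) T); [exact: ih|exact: cT].
Qed.

Lemma davg_measurable (n : nat) (c : X) :
  measurable_fun [set: borel X] ((fun x : X => davg T n x c) : borel X -> R).
Proof.
apply: measurable_funM => //.
apply: measurable_sum => k.
under eq_fun do rewrite metric_sym.
apply: (@continuous_borel_measurable R X (fun x => mdist (iter k T c) (iter k T x))) => x.
apply: (@continuous_comp _ _ _ (iter k T) (mdist (iter k T c))).
  exact: iter_continuous.
exact: mdist_continuous.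
Qed.

(** The coupling is deterministic: the source is the identity on [X] and the
    word is the orbit of a point of [F] chosen measurably close to [x]. *)
Lemma rate_distortion_le_ln_card (mu : probability (borel X) R) (n : nat)
    (eps : R) (F : {fset X}) :
  (0 < n)%N -> (forall x, exists2 c, c \in F & davg T n x c <= eps) ->
  (rate_distortion T mu eps <= (n%:R^-1 * ln #|` F|%:R)%:E)%E.
Proof.
move=> n0 cov.
have [c0 c0F _] := cov point.
pose U (e : F) : set X := [set x | davg T n x (val e) <= eps].
pose sel (s : {set F}) : F := odflt [` c0F]%fset [pick e in s].
pose Z (x : borel X) : F := sel (atom_label U x).
have mA : discrete_measurable (atom_label U : borel X -> _).
  apply: (@atom_class X _ U (fun A => measurable (A : set (borel X)))) => //.
  - by move=> A; exact: measurableC.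
  - by move=> A B; exact: measurableI.
  - move=> e; have := @davg_measurable n (val e) measurableT `]-oo, eps]%classic.
    rewrite setTI => /(_ (measurable_itv _)).
    by congr measurable; apply/seteqP; split => x /=; rewrite in_itv.
have mZ : discrete_measurable Z by exact: discrete_measurable_comp.
have Zx x : davg T n x (val (Z x)) <= eps.
  rewrite /Z /sel; case: pickP => [e|h]; first by rewrite inE => /asboolP.
  have [c cF xc] := cov x; have := h [` cF]%fset.
  by rewrite inE => /negP; case; exact/asboolP.
pose y0 (e : F) : n.-tuple (borel X) := [tuple iter k T (val e) | k < n].
pose Y x := y0 (Z x).
have mY : measurable_fun [set: borel X] Y.
  move=> _ S mS; rewrite setTI.
  rewrite (_ : _ @^-1` _ = \bigcup_(e in [set e | S (y0 e)]) (Z @^-1` [set e])).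
    by apply: fin_bigcup_measurable => //; exact: finite_finset.
  by apply/seteqP; split => x /=; [exists (Z x)|move=> [c Sc /= Zc]; rewrite /Y Zc].
apply: (@le_trans _ _ ((n%:R^-1)%:E * mutual_info mu (fun x : borel X => x) Y)%E).
  apply: ereal_inf_lbound; exists n, _, (borel X), mu, id, Y; split => //.
  split => //.
  have eps0 : 0 <= eps.
    apply: le_trans (Zx point); rewrite /davg mulr_ge0 ?invr_ge0//.
    by apply: sumr_ge0 => k _; exact: mdist_ge0.
  rewrite unlock.
  apply: (@le_trans _ _ (\int[mu]_(w in setT) (cst eps%:E w))%E); last first.
    by rewrite integral_cst// [X in (_ * X)%E](_ : _ = 1%E) ?mule1//;
      exact: (@probability_setT _ _ _ mu).
  apply: ge0_integral_mono => x; rewrite lee_fin.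
    rewrite mulr_ge0 ?invr_ge0//.
    by apply: sumr_ge0 => k _; exact: mdist_ge0.
  apply: le_trans (Zx x); rewrite /davg ler_wpM2l ?invr_ge0//.
  by apply: ler_sum => k _; rewrite tnth_mktuple.
rewrite EFinM; apply: lee_wpmul2l; first by rewrite lee_fin invr_ge0.
apply: ge_ereal_sup => _ [A [B [alpha [beta [ma mb ->]]]]].
rewrite lee_fin cardfE.
apply: (@finite_mutual_info_le_ln_card _ _ _ mu A B F alpha Z (beta \o y0)) => //.
Qed.

End RateUpperBound.

(** * Finite partitions of a compact metric space *)

Section CompactMetric.
Variables (R : realType) (X : pointedMetricType R).
Hypothesis cX : compact [set: X].

Lemma finite_ball_cover (rho : X -> R) : (forall x, 0 < rho x) ->
  exists D : {fset X}, forall x, exists2 c, c \in D & mdist c x < rho c.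
Proof.
move=> rho0; move: cX; rewrite compact_cover.
move=> /(_ X setT (fun c => [set x | mdist c x < rho c])) [].
- by move=> c _; exact: open_mdist_lt.
- by move=> x _; exists x => //=; rewrite mdistxx.
move=> D _ DX; exists D => x; have [c /= cD cx] := DX x I.
by exists c.
Qed.

Lemma compact_diameter : exists D : R, forall u v : X, mdist u v <= D.
Proof.
have [F Fcov] := @finite_ball_cover (fun=> 1) (fun=> ltr01).
pose M : R := \sum_(c <- F) mdist point c + 1.
have bM (x : X) : mdist point x <= M.
  have [c cF cx] := Fcov x.
  apply: le_trans (metric_triangle _ c _) _; apply: lerD; last exact: ltW.
  rewrite (big_fsetD1 c)//= lerDl; apply: sumr_ge0 => ? _; exact: mdist_ge0.
exists (M + M) => u v; apply: le_trans (metric_triangle _ point _) _.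
by rewrite metric_sym lerD.
Qed.

Lemma positive_lower_bound (I : eqType) (s : seq I) (rho : I -> R) :
  (forall i, 0 < rho i) -> exists2 r, 0 < r & forall i, i \in s -> r <= rho i.
Proof.
move=> rho0; elim: s => [|j s [r r0 ih]]; first by exists 1.
exists (Num.min (rho j) r); first by rewrite lt_min rho0.
move=> i; rewrite inE ge_min => /predU1P[->|/ih ->]; last by rewrite orbT.
by rewrite lexx.
Qed.

Lemma uniform_continuity (f : X -> X) (eta : R) : continuous f -> 0 < eta ->
  exists2 r, 0 < r & forall u v, mdist u v < r -> mdist (f u) (f v) < eta.
Proof.
move=> cf eta0.
have ex x : exists r, 0 < r /\
    forall u, mdist x u < r + r -> mdist (f x) (f u) < eta / 2.
  have : nbhs x (f @^-1` ball (f x) (eta / 2)).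
    by apply: cf; apply: nbhsx_ballx; rewrite divr_gt0.
  move=> /nbhs_ballP[r /= r0 rf]; exists (r / 2); split; first by rewrite divr_gt0.
  by move=> u; rewrite -splitr => xu; have := rf u; rewrite !ballEmdist; apply.
have [rho hrho] := choice ex.
have [F Fcov] := finite_ball_cover (fun x => (hrho x).1).
have [r r0 rF] := positive_lower_bound F (fun x => (hrho x).1).
exists r => //.
move=> u v uv; have [c cF cu] := Fcov u.
have rc : mdist u v < rho c by exact: lt_le_trans uv (rF _ cF).
have h1 : mdist (f c) (f u) < eta / 2.
  by apply: (hrho c).2; apply: lt_trans cu _; rewrite ltrDl; case: (hrho c).
have h2 : mdist (f c) (f v) < eta / 2.
  by apply: (hrho c).2; apply: le_lt_trans (metric_triangle _ u _) _; rewrite ltrD.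
apply: le_lt_trans (metric_triangle _ (f c) _) _.
by rewrite metric_sym [ltRHS]splitr ltrD.
Qed.

(** Finitely many iterates are uniformly continuous together, which allows
    replacing a point by the representative of its class for a whole block. *)
Lemma uniform_continuity_iter (T : X -> X) (m : nat) (eta : R) :
  continuous T -> 0 < eta ->
  exists2 r, 0 < r & forall u v, mdist u v < r ->
    forall k, (k < m)%N -> mdist (iter k T u) (iter k T v) < eta.
Proof.
move=> cT eta0; elim: m => [|m [r r0 ih]]; first by exists 1.
have [r' r'0 h] := uniform_continuity (iter_continuous cT (k := m)) eta0.
exists (Num.min r r'); first by rewrite lt_min r0.
move=> u v; rewrite lt_min => /andP[ur ur'] k; rewrite ltnS leq_eqVlt.
by move=> /predU1P[->|km]; [exact: h|exact: ih].
Qed.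

(** The atoms of a finite cover by balls with null spheres. *)
Lemma exists_continuity_partition (mu : probability (borel X) R) (r : R) :
  0 < r ->
  exists (A : finType) (alpha : X -> A) (rep : A -> X),
    [/\ forall a, measurable (alpha @^-1` [set a] : set (borel X)),
        forall a, continuity_set mu (alpha @^-1` [set a])
      & forall x, mdist x (rep (alpha x)) < r].
Proof.
move=> r0.
have r2 : 0 < r / 2 by rewrite divr_gt0.
have [rho hrho] := choice (fun x => exists_null_sphere mu x r2).
have [F Fcov] := @finite_ball_cover rho (fun x => let: And3 h _ _ := hrho x in h).
pose U (c : F) : set X := [set x | mdist (val c) x < rho (val c)].
pose alpha := atom_label U.
have ex (a : {set F}) : exists x, (exists y, alpha y = a) -> alpha x = a.
  have [[y ya]|no] := pselect (exists y, alpha y = a); first by exists y.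
  by exists point.
have [rep hrep] := choice ex.
exists {set F}, alpha, rep; split.
- apply: (atom_class (K := fun A => measurable (A : set (borel X)))) => //.
  + by move=> A; exact: measurableC.
  + by move=> A B; exact: measurableI.
  + by move=> c; apply: open_borel; exact: open_mdist_lt.
- apply: atom_class.
  + exact: continuity_set_setT.
  + by move=> A; exact: continuity_setC.
  + by move=> A B; exact: continuity_setI.
  + by move=> c; apply: continuity_set_ball; case: (hrho (val c)).
- move=> x; have [c cF cx] := Fcov x.
  have ea : alpha (rep (alpha x)) = alpha x by apply: hrep; exists x.
  have cr : mdist c (rep (alpha x)) < rho c.
    have : [` cF]%fset \in alpha (rep (alpha x)).
      by rewrite ea inE; exact/asboolP.
    by rewrite inE => /asboolP.
  have [_ rc _] := hrho c.
  apply: le_lt_trans (metric_triangle _ c _) _.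
  by rewrite metric_sym [ltRHS]splitr ltrD// (lt_trans _ rc).
Qed.

End CompactMetric.

(** * Lower bound for the rate distortion function *)

Section CodingLimit.
Variables (R : realType) (X : pointedMetricType R) (T : X -> X).
Variables (U : set_system nat) (E : nat -> {fset X}).
Hypotheses (UU : UltraFilter U) (Uoo : forall k, U [set n | (k <= n)%N]).
Hypothesis E0 : forall n, (0 < #|` E n|)%N.

Lemma orbit_average_label (A : finType) (alpha : X -> A) (phi : A -> R) n :
  orbit_average T E n (phi \o alpha) =
  \sum_a phi a * orbit_average T E n (\1_(alpha @^-1` [set a])).
Proof.
rewrite /orbit_average.
under [RHS]eq_bigr do rewrite mulrCA.
rewrite -mulr_sumr; congr (_ * _).
under [RHS]eq_bigr do rewrite mulr_sumr.
rewrite [RHS]exchange_big/=; apply: eq_bigr => e _.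
under [RHS]eq_bigr do rewrite mulr_sumr.
rewrite [RHS]exchange_big/=; apply: eq_bigr => t _.
rewrite (bigD1 (alpha (iter t T e)))//= indicE mem_set// mulr1 big1 ?addr0//.
move=> a aN; rewrite indicE memNset ?mulr0//= => /esym/eqP.
by rewrite (negPf aN).
Qed.

Lemma orbit_average_label_cvg (A : finType) (alpha : X -> A) (phi : A -> R) :
  orbit_average T E n (phi \o alpha) @[n --> U] -->
  \sum_a phi a * limit_content T U E (alpha @^-1` [set a]).
Proof.
rewrite (_ : (fun n => _) = fun n =>
  \sum_a phi a * orbit_average T E n (\1_(alpha @^-1` [set a]))); last first.
  by apply/funext => n; rewrite orbit_average_label.
elim: (index_enum A) => [|a l ih].
  rewrite big_nil (_ : (fun n => _) = fun=> 0); first exact: cvg_cst.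
  by apply/funext => n; rewrite big_nil.
rewrite big_cons (_ : (fun n => _) = fun n =>
  phi a * orbit_average T E n (\1_(alpha @^-1` [set a])) +
  \sum_(a <- l) phi a * orbit_average T E n (\1_(alpha @^-1` [set a]))).
  by apply: cvgD => //; apply: cvgMr; exact: orbit_average_cvg.
by apply/funext => n; rewrite big_cons.
Qed.

Lemma cvg_ultra_invn : (n%:R^-1 : R) @[n --> U] --> (0 : R).
Proof.
apply/cvgrPdist_le => e e0.
apply: filterS (Uoo (Num.truncn e^-1).+1) => n /= en.
have n0 : (0 < n)%N by exact: leq_ltn_trans en.
rewrite sub0r normrN ger0_norm ?invr_ge0//.
rewrite -[leRHS]invrK lef_pV2 ?posrE ?invr_gt0 ?ltr0n//.
by apply/ltW; apply: lt_le_trans (truncnS_gt _) _; rewrite ler_nat.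
Qed.

Variables (A B : finType) (m : nat) (alpha : X -> A).
Variables (q : A -> B -> R) (r : B -> R) (y : B -> 'I_m -> X) (cost : A -> R).
Variables (D eps s theta : R).

(** Divided by [n #|E n|], the bound of [block_coding_bound] involves only orbit
    averages of functions of the label, and [(ln #|E n|) / n >= s].  The
    assumption on the limit of the average costs keeps the failure probability
    of the decoding below [1 - theta] eventually. *)
Lemma coding_limit_bound :
  (0 < m)%N -> 0 < eps -> 0 <= theta <= 1 ->
  (forall u v : X, mdist u v <= D) ->
  (forall a b, 0 <= q a b) -> (forall b, 0 <= r b) ->
  (forall a b, 0 < q a b -> 0 < r b) ->
  (forall a, \sum_b q a b = 1) -> \sum_b r b = 1 ->
  (forall x, \sum_b q (alpha x) b * \sum_(k < m) mdist (iter k T x) (y b k)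
     <= cost (alpha x)) ->
  (\forall n \near U, separated (davg T n) eps [set` E n] /\
     s * n%:R <= ln #|` E n|%:R) ->
  (\sum_a cost a * limit_content T U E (alpha @^-1` [set a])) *+ 2
    < (1 - theta) * eps * m%:R ->
  m%:R * s * theta <= \sum_a rel_entropy (q a) r *
     limit_content T U E (alpha @^-1` [set a]).
Proof.
move=> m0 eps0 /andP[th0 th1] dD q0 r0 qr q1 r1 hcost goodE small.
have mR : 0 < m%:R :> R by rewrite ltr0n.
have D0 : 0 <= D by exact: le_trans (mdist_ge0 _ _) (dD point point).
set C := \sum_a cost a * _ in small.
set I := \sum_a _ * _.
have cC : orbit_average T E n (cost \o alpha) @[n --> U] --> C.
  exact: orbit_average_label_cvg.
have cI : orbit_average T E n ((fun a => rel_entropy (q a) r) \o alpha) @[n --> U]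
    --> I by exact: orbit_average_label_cvg.
(* The margin [tau] of the block code behaves like [n * eps / 2]. *)
pose tau n : R := (n%:R * eps - D *+ (m * 2)) / 2.
have ctau : tau n / n%:R @[n --> U] --> eps / 2.
  have : (eps - (D *+ (m * 2)) * n%:R^-1) / 2 @[n --> U] --> (eps - (D *+ (m * 2)) * 0) / 2.
    apply: cvgMl; apply: cvgB; first exact: cvg_cst.
    by apply: cvgMr; exact: cvg_ultra_invn.
  rewrite mulr0 subr0; apply: cvg_trans; apply: near_eq_cvg.
  apply: filterS (Uoo 1) => n /= n0; rewrite /tau.
  by field; rewrite pnatr_eq0 -lt0n.
have near1 : \forall n \near U, 0 < tau n / n%:R.
  by apply: (cvgr_gt _ ctau); rewrite divr_gt0.
have near2 : \forall n \near U, 0 <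
    (1 - theta) * m%:R * (tau n / n%:R) - orbit_average T E n (cost \o alpha).
  apply: (cvgr_gt ((1 - theta) * m%:R * (eps / 2) - C)).
    by apply: cvgB => //; apply: cvgMr.
  rewrite subr_gt0 -(ltr_pMn2r (n := 2))//.
  by apply: (lt_le_trans small); rewrite -mulr_natr; lra.
have : \forall n \near U, m%:R * s * theta <=
   orbit_average T E n ((fun a => rel_entropy (q a) r) \o alpha) + m%:R * n%:R^-1.
  near=> n.
  have n1 : (2 * m <= n)%N by near: n; exact: Uoo.
  have n0 : (0 < n)%N by apply: leq_trans n1; rewrite muln_gt0.
  have nR : 0 < n%:R :> R by rewrite ltr0n.
  have [sepE lnE] : separated (davg T n) eps [set` E n] /\
     s * n%:R <= ln #|` E n|%:R by near: n.
  have tau0 : 0 < tau n.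
    have : 0 < tau n / n%:R by near: n.
    by rewrite pmulr_lgt0 ?invr_gt0.
  have ca : orbit_average T E n (cost \o alpha) <=
      (1 - theta) * m%:R * (tau n / n%:R).
    by apply/ltW; rewrite -subr_gt0; near: n.
  have card0 : (0 < #|{: E n}|)%N by rewrite -cardfE.
  have sep (e e' : E n) : e <> e' ->
      n%:R * eps < \sum_(t < n) mdist (iter t T (val e)) (iter t T (val e')).
    move=> ee'; have := sepE (val e) (val e') (valP e) (valP e').
    move=> /(_ (fun h => ee' (val_inj h))); rewrite /davg.
    by rewrite -(ltr_pM2l nR) mulrA mulfV ?gt_eqF// mul1r.
  have := @block_coding_bound R X (E n) A B n m eps D (tau n)
    (fun e t => iter t T (val e)) (fun e t => alpha (iter t T (val e))) q r y
    m0 n1 card0 dD sep q0 r0 qr q1 r1 tau0.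
  have -> : n%:R * eps = tau n *+ 2 + D *+ (m * 2).
    by rewrite /tau -[_ / 2 *+ 2]mulr_natr divfK ?subrK// pnatr_eq0.
  move=> /(_ erefl); rewrite -cardfE.
  set N := #|` E n|%:R in lnE *.
  have N0 : 0 < N by rewrite ltr0n.
  have lnN0 : 0 <= ln N by rewrite ln_ge0// ler1n.
  rewrite -(big_seq_fsetE _ _ xpredT (fun e => \sum_(t < n)
     rel_entropy (q (alpha (iter t T e))) r))/=.
  have avgE (f : X -> R) : \sum_(e <- E n) \sum_(t < n) f (iter t T e) =
      n%:R * N * orbit_average T E n f.
    by rewrite /orbit_average mulrA mulfV ?mul1r// mulf_neq0 ?gt_eqF.
  rewrite (avgE ((fun a => rel_entropy (q a) r) \o alpha)).
  set F := orbit_average _ _ _ _.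
  set G := \sum_e \sum_(t < n) _.
  have hG : G <= n%:R * N * orbit_average T E n (cost \o alpha).
    rewrite -avgE big_seq_fsetE/=; apply: ler_sum => e _; apply: ler_sum => t _.
    apply: le_trans (hcost _); apply: ler_sum => b _.
    by apply: ler_wpM2l => //; apply: ler_sum => k _; rewrite addnC iterD.
  move=> main.
  have hG' : ln N / tau n * G <= N * ln N * (1 - theta) * m%:R.
    apply: (@le_trans _ _ (ln N / tau n * (n%:R * N * ((1 - theta) * m%:R * (tau n / n%:R))))).
      apply: ler_wpM2l; first by rewrite divr_ge0// ltW.
      by apply: (le_trans hG); apply: ler_wpM2l => //; rewrite mulr_ge0// ltW.
    rewrite le_eqVlt; apply/orP; left; apply/eqP; field.
    by rewrite !gt_eqF.
  have h1 : m%:R * N * (theta * ln N) - m%:R * N <= n%:R * N * F by lra.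
  have h2 : theta * (s * n%:R) <= theta * ln N by exact: ler_wpM2l.
  have h3 : m%:R * (theta * (s * n%:R)) - m%:R <= n%:R * F.
    rewrite -(ler_pM2l N0); apply: le_trans (_ : _ <= n%:R * N * F) _; last by lra.
    apply: le_trans h1; have := ler_wpM2l (ltW (mulr_gt0 mR N0)) h2; lra.
  have h4 : n%:R * (m%:R * n%:R^-1) = m%:R :> R by field; rewrite gt_eqF.
  by rewrite -(ler_pM2l nR) mulrDr h4; lra.
have ch : orbit_average T E n ((fun a => rel_entropy (q a) r) \o alpha) +
    m%:R * n%:R^-1 @[n --> U] --> I + m%:R * 0.
  by apply: cvgD => //; apply: cvgMr; exact: cvg_ultra_invn.
rewrite mulr0 addr0 in ch.
exact: cvgr_to_ge ch.
Unshelve. all: by end_near. Qed.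

End CodingLimit.

Lemma limn_esup_frequently (R : realType) (u : nat -> \bar R) (s : \bar R) :
  (s < limn_esup u)%E -> forall k, exists2 n, (k <= n)%N & (s < u n)%E.
Proof.
move=> su k; apply: contrapT => h; move: su; apply/negP; rewrite -leNgt.
apply: (@le_trans _ _ (ereal_sup (u @` [set n | (k <= n)%N]))).
  by apply: ereal_inf_lbound; exists [set n | (k <= n)%N] => //; exists k.
apply: ge_ereal_sup => _ [n kn <-]; rewrite leNgt; apply/negP => su.
by apply: h; exists n.
Qed.

Section RateLowerBound.
Variables (R : realType) (X : pointedMetricType R) (T : X -> X).

Lemma exists_ultrafilter_within (G : set nat) :
  (forall k, exists2 n, (k <= n)%N & G n) ->
  exists U : set_system nat, [/\ UltraFilter U, U G &
    forall k, U [set n | (k <= n)%N]].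
Proof.
move=> Gfreq.
have PF : ProperFilter (within G \oo).
  apply: Build_ProperFilter_ex => A [k _ kA].
  by have [n kn Gn] := Gfreq k; exists n; exact: kA.
have [U [UU FU]] := ultraFilterLemma PF.
exists U; split => // [|k]; apply: FU.
  by exists 0%N.
by exists k => // n /= kn _.
Qed.

(** The upper limit exceeds [s], so infinitely many terms do, and a supremum of
    cardinalities exceeding [exp (s n)] is exceeded by a cardinality. *)
Lemma frequently_separated (eps s : R) :
  (s%:E < avg_sep_entropy T eps)%E ->
  forall k, exists2 n, (k <= n)%N & exists E : {fset X},
    [/\ (0 < #|` E|)%N, separated (davg T n) eps [set` E]
      & s * n%:R <= ln #|` E|%:R].
Proof.
move=> /limn_esup_frequently h k; have [n kn] := h k.+1.
have nR : 0 < n%:R :> R by rewrite ltr0n; exact: leq_ltn_trans kn.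
rewrite inver gt_eqF// lte_pdivlMr// => sn.
exists n; first exact: ltnW.
apply: contrapT => nE; move: sn; apply/negP; rewrite -leNgt -EFinM.
apply: lne_max_separated_le => E E0 sE; rewrite leNgt; apply/negP => sn.
by apply: nE; exists E; split => //; exact: ltW.
Qed.

(** Quantization of a coupling [(Xi, Y)] of block length [m] by a finite
    measurable partition [alpha] with representatives [rep].  Information can
    only decrease, and the distortion increases by at most [2 eta]. *)
Section Distortion.
Variables (mu : probability (borel X) R) (d : measure_display).
Variables (W : measurableType d) (P : probability W R) (m : nat) (delta : R).
Variables (Xi : W -> borel X) (Y : W -> m.-tuple (borel X)).
Variables (A : finType) (alpha : X -> A) (rep : A -> X) (eta : R).
Hypotheses (m0 : (0 < m)%N) (hXY : distortion_condition T delta mu P Xi Y).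
Hypothesis malpha : forall a, measurable (alpha @^-1` [set a] : set (borel X)).
Hypothesis repE : forall x k, (k < m)%N ->
  mdist (iter k T x) (iter k T (rep (alpha x))) <= eta.

Let beta (y : m.-tuple (borel X)) : {ffun 'I_m -> A} :=
  [ffun k => alpha (tnth y k)].

Let measurable_label_fin (d' : measure_display) (S : measurableType d')
    (C : finType) (f : S -> C) :
  (forall c, measurable (f @^-1` [set c])) -> measurable_label f.
Proof.
move=> mf B.
rewrite (_ : _ @^-1` _ = \bigcup_(c in B) (f @^-1` [set c])).
  by apply: fin_bigcup_measurable => //; exact: finite_finset.
by apply/seteqP; split => w /=; [exists (f w)|move=> [c Bc /= ->]].
Qed.

Let mlalpha : measurable_label (alpha : borel X -> A).
Proof. exact: measurable_label_fin. Qed.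

Let mlbeta : measurable_label beta.
Proof.
apply: measurable_label_fin => b.
rewrite (_ : _ @^-1` _ = \big[setI/setT]_(k < m)
    ((fun y : m.-tuple (borel X) => tnth y k) @^-1` (alpha @^-1` [set b k]))).
  apply: bigsetI_measurable => k _.
  by rewrite -[X in measurable X]setTI; exact: measurable_tnth.
apply/seteqP; split => y /=; rewrite -bigcap_seq.
  by move=> <- k _ /=; rewrite ffunE.
by move=> h; apply/ffunP => k; rewrite ffunE; exact: (h k (mem_index_enum k)).
Qed.

Let Z1 w := alpha (Xi w).
Let Z2 w := beta (Y w).

Let mXi : measurable_fun [set: W] Xi. Proof. by case: hXY. Qed.
Let mY : measurable_fun [set: W] Y. Proof. by case: hXY. Qed.

Let mZ1 : discrete_measurable Z1.
Proof.
move=> a; rewrite (_ : _ @^-1` _ = Xi @^-1` (alpha @^-1` [set a]))//.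
rewrite -[X in measurable X]setTI; exact: mXi.
Qed.

Let mZ2 : discrete_measurable Z2.
Proof.
move=> b; rewrite (_ : _ @^-1` _ = Y @^-1` (beta @^-1` [set b]))//.
rewrite -[X in measurable X]setTI; apply: mY => //; exact: mlbeta.
Qed.

Definition quantized_joint : A -> {ffun 'I_m -> A} -> R := joint_mass P Z1 Z2.

Lemma quantized_joint_ge0 a b : 0 <= quantized_joint a b.
Proof. exact: joint_mass_ge0. Qed.

Lemma sum_quantized_joint : \sum_a \sum_b quantized_joint a b = 1.
Proof. exact: sum_joint_mass. Qed.

Lemma quantized_marginal a :
  (marginal1 quantized_joint a)%:E = mu (alpha @^-1` [set a]).
Proof.
rewrite marginal1_joint// /label_mass.
case: hXY => _ _ XiE _; rewrite -XiE// fineK// fin_num_measure//.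
Qed.

Lemma quantized_information_le :
  ((mutual_information_sum quantized_joint)%:E <= mutual_info P Xi Y)%E.
Proof.
rewrite -finite_mutual_infoE//; apply: ereal_sup_ubound.
by exists A, {ffun 'I_m -> A}, alpha, beta; split.
Qed.

Definition quantized_distortion (a : A) (b : {ffun 'I_m -> A}) : R :=
  \sum_(k < m) mdist (iter k T (rep a)) (rep (b k)).

Lemma quantized_distortion_le : 
  \sum_a \sum_b quantized_joint a b * quantized_distortion a b <=
  m%:R * (delta + eta *+ 2).
Proof.
have mR : 0 < m%:R :> R by rewrite ltr0n.
(* A nonnegative function of the labels that lies below the true distortion. *)
pose h (c : A * {ffun 'I_m -> A}) : R :=
  Num.max 0 (m%:R^-1 * quantized_distortion c.1 c.2 - eta *+ 2).
have le1 : \sum_c h c * label_mass P (fun w => (Z1 w, Z2 w)) c <= delta.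
  case: hXY => _ _ _ hE; apply: (label_expectation_le _ _ _ hE).
  - exact: discrete_measurable_pair.
  - by move=> c; rewrite le_max lexx.
  move=> w; rewrite ge_max; apply/andP; split.
    rewrite mulr_ge0 ?invr_ge0//; apply: sumr_ge0 => k _; exact: mdist_ge0.
  rewrite lerBlDr -(ler_pM2l mR) mulrDr !mulrA !mulfV ?gt_eqF// !mul1r.
  rewrite mulr_natl -[X in _ *+ X](card_ord m) -sumr_const -big_split/=.
  apply: ler_sum => k _; rewrite /Z2 ffunE.
  apply: le_trans (metric_triangle _ (iter k T (Xi w)) _) _.
  rewrite metric_sym mulr2n addrCA; apply: lerD; first exact: repE.
  apply: le_trans (metric_triangle _ (tnth (Y w) k : X) _) _.
  by rewrite lerD2l; exact: (repE (tnth (Y w) k) m0).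
rewrite pair_bigA/=.
apply: (@le_trans _ _ (\sum_c (m%:R * (h c * label_mass P (fun w => (Z1 w, Z2 w)) c)
   + m%:R * (eta *+ 2) * label_mass P (fun w => (Z1 w, Z2 w)) c))).
  apply: ler_sum => -[a b] _ /=.
  rewrite [quantized_joint _ _]/(label_mass P (fun w => (Z1 w, Z2 w)) (a, b)).
  rewrite mulrA -mulrDl mulrC ler_wpM2r ?label_mass_ge0//.
  rewrite -mulrDr -ler_pdivrMl//; rewrite -lerBlDr /h le_max /= lexx orbT//.
rewrite big_split/= -!mulr_sumr sum_label_mass; last exact: discrete_measurable_pair.
rewrite mulr1 -mulrDr; apply: ler_wpM2l; first exact: ltW.
by rewrite lerD2r.
Qed.

End Distortion.

End RateLowerBound.

Section RateLowerBoundMain.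
Variables (R : realType) (X : pointedMetricType R) (T : X -> X).
Hypotheses (cX : compact [set: X]) (cT : continuous T).

(** The measure only depends on the sets [E n], not on the coupling, which is
    arbitrary: the partition is chosen after the coupling, in terms of its
    block length. *)
Lemma exists_invariant_rate_ge (eps delta theta s : R) :
  0 < eps -> 0 <= theta <= 1 -> delta *+ 2 < (1 - theta) * eps ->
  (s%:E < avg_sep_entropy T eps)%E ->
  exists2 mu : probability (borel X) R, invariant_measure T mu &
    ((theta * s)%:E <= rate_distortion T mu delta)%E.
Proof.
move=> eps0 th01 dth slt.
pose good n (E : {fset X}) := separated (davg T n) eps [set` E] /\
  s * n%:R <= ln #|` E|%:R.
have [U [UU UG Uoo]] : exists U : set_system nat, [/\ UltraFilter U,
    U [set n | exists2 E : {fset X}, (0 < #|` E|)%N & good n E] &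
    forall k, U [set n | (k <= n)%N]].
  apply: exists_ultrafilter_within => k.
  have [n kn [E [E0 sE lE]]] := frequently_separated slt k.
  by exists n => //; exists E.
have exE n : exists E : {fset X}, (0 < #|` E|)%N /\
    ((exists2 E : {fset X}, (0 < #|` E|)%N & good n E) -> good n E).
  have [[E E0 gE]|no] :=
    pselect (exists2 E : {fset X}, (0 < #|` E|)%N & good n E).
    by exists E.
  by exists [fset point]%fset; rewrite cardfs1.
have [E hE] := choice exE.
have E0 n : (0 < #|` E n|)%N by case: (hE n).
have goodE : \forall n \near U, good n (E n).
  by apply: filterS UG => n; exact: (hE n).2.
have [mu mu_inv muL] := exists_limit_measure cX cT
  (limit_content_fap T UU Uoo E0) (limit_content_preimage T UU Uoo E0).
exists mu => //.
apply: le_ereal_inf_tmp => _ [m [d [W [P [Xi [Y [m0 hXY ->]]]]]]].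
have mR : 0 < m%:R :> R by rewrite ltr0n.
(* Per unit of time the cost exceeds [delta] by at most [3 * eta], the slack being [4 * eta]. *)
pose eta := ((1 - theta) * eps / 2 - delta) / 4.
have eta0 : 0 < eta.
  by rewrite /eta divr_gt0// subr_gt0 ltr_pdivlMr// mulr_natr.
have [r0 r00 hr0] := uniform_continuity_iter cX m cT eta0.
have [A [alpha [rep [malpha calpha arep]]]] :=
  exists_continuity_partition cX mu r00.
have repE x k : (k < m)%N ->
    mdist (iter k T x) (iter k T (rep (alpha x))) <= eta.
  by move=> km; apply/ltW; apply: hr0.
have [D dD] := compact_diameter cX.
pose p := quantized_joint P Xi Y alpha.
have p0 a b : 0 <= p a b by exact: quantized_joint_ge0.
have p1 : \sum_a \sum_b p a b = 1.
  exact: (sum_quantized_joint hXY malpha).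
have Lp a : limit_content T U E (alpha @^-1` [set a]) = marginal1 p a.
  have := quantized_marginal hXY malpha a; rewrite muL// => -[<-//].
pose q := conditional p.
pose cost a := \sum_b q a b * quantized_distortion T rep a b + m%:R * eta.
have hcost x : \sum_b q (alpha x) b *
     \sum_(k < m) mdist (iter k T x) (rep (b k)) <= cost (alpha x).
  rewrite /cost -[m%:R * eta]mul1r.
  rewrite -[X in X * (m%:R * eta)](sum_conditional p1 (alpha x)).
  rewrite mulr_suml -big_split/=; apply: ler_sum => b _.
  rewrite -mulrDr; apply: ler_wpM2l; first exact: conditional_ge0.
  rewrite /quantized_distortion mulr_natl -[X in _ *+ X](card_ord m).
  rewrite -sumr_const -big_split/=; apply: ler_sum => k _.
  apply: le_trans (metric_triangle _ (iter k T (rep (alpha x))) _) _.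
  by rewrite [leRHS]addrC lerD2r repE.
have costL : \sum_a cost a * limit_content T U E (alpha @^-1` [set a]) <=
    m%:R * (delta + eta *+ 3).
  have -> : \sum_a cost a * limit_content T U E (alpha @^-1` [set a]) =
      \sum_a \sum_b p a b * quantized_distortion T rep a b + m%:R * eta.
    rewrite -[m%:R * eta]mul1r -[X in X * (m%:R * eta)](sum_marginal1 p1).
    rewrite mulr_suml -big_split/=; apply: eq_bigr => a _.
    rewrite Lp /cost mulrDl [m%:R * eta * _]mulrC; congr (_ + _).
    rewrite mulr_suml; apply: eq_bigr => b _.
    by rewrite mulrAC [q a b * _]mulrC marginal1_conditional.
  have := quantized_distortion_le m0 hXY malpha repE.
  by rewrite -/p => h; rewrite !mulrDr; move: h; rewrite mulrDr; lra.
have small : (\sum_a cost a * limit_content T U E (alpha @^-1` [set a])) *+ 2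
    < (1 - theta) * eps * m%:R.
  apply: (@le_lt_trans _ _ (m%:R * (delta + eta *+ 3) *+ 2)).
    by rewrite ler_pMn2r.
  rewrite -mulrnAr mulrC ltr_pM2r//.
  have : eta * 4 = (1 - theta) * eps / 2 - delta by rewrite /eta divfK.
  by lra.
have bound := coding_limit_bound UU Uoo E0 m0 eps0 th01 dD
  (conditional_ge0 p0) (marginal2_ge0 p0) (@conditional_gt0 _ _ _ _ p0)
  (sum_conditional p1) (sum_marginal2 p1) hcost goodE small.
rewrite -(@lee_pmul2l _ m%:R%:E)// ?lte_fin// muleA -!EFinM mulfV ?gt_eqF// mul1e.
apply: le_trans (quantized_information_le hXY malpha).
rewrite lee_fin mulrA mulrAC; apply: (le_trans bound).
rewrite (mutual_information_rel_entropy p0).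
by apply/ler_sum => a _; rewrite Lp mulrC.
Qed.

End RateLowerBoundMain.

(** * Separated sets for the maximal and for the averaged distance *)

Section Counting.
Variables (R : realType) (X : pointedMetricType R) (T : X -> X).

Lemma davgC n (x y : X) : davg T n x y = davg T n y x.
Proof. by congr (_ * _); apply: eq_bigr => k _; rewrite metric_sym. Qed.

Lemma davgxx n (x : X) : davg T n x x = 0.
Proof. by rewrite /davg big1 ?mulr0// => k _; rewrite mdistxx. Qed.

Lemma davg_le_dmax n (x y : X) : davg T n x y <= dmax T n x y.
Proof.
have [->|n0] := posnP n; first by rewrite /davg /dmax !big_ord0 mulr0.
rewrite /davg ler_pdivrMl ?ltr0n// mulr_natl -[X in _ *+ X](card_ord n).
by rewrite -sumr_const; apply: ler_sum => k _; exact: le_bigmax.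
Qed.

(** The code of a point [x] of [E] consists of a point of [F] close to [x] for
    the averaged distance, of the set of times when their orbits are farther
    than [L eps'] apart, and of the balls containing the orbit of [x] at these
    times, listed in a word whose length does not depend on [x]. *)
Lemma card_dmax_separated_le (n : nat) (eps eps' L : R) (E F C : {fset X}) :
  (0 < n)%N -> 0 < eps' -> 1 <= L -> L * eps' *+ 2 <= eps ->
  separated (dmax T n) eps [set` E] ->
  (forall x, exists2 c, c \in F & davg T n x c <= eps') ->
  (forall x, exists2 c, c \in C & mdist c x < eps') ->
  (#|` E| <= #|` F| * 2 ^ n * #|` C| ^ Num.truncn (n%:R / L))%N.
Proof.
move=> n0 e0 L1 Le sE covF covC.
have L0 : 0 < L by exact: lt_le_trans L1.
have nR : 0 < n%:R :> R by rewrite ltr0n.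
set r := Num.truncn _.
have [f hf] := choice (fun x => let: ex_intro2 c h1 h2 := covF x in
  ex_intro (fun c : F => davg T n x (val c) <= eps') [` h1]%fset h2).
have [k hk] := choice (fun x => let: ex_intro2 c h1 h2 := covC x in
  ex_intro (fun c : C => mdist (val c) x < eps') [` h1]%fset h2).
pose far (x : X) : {ffun 'I_n -> bool} :=
  [ffun t : 'I_n => L * eps' < mdist (iter t T x) (iter t T (val (f x)))].
pose farseq (g : {ffun 'I_n -> bool}) : seq 'I_n := enum [pred t | g t].
pose code (x : E) : F * {ffun 'I_n -> bool} * {ffun 'I_r -> C} :=
  (f (val x), far (val x),
   [ffun i : 'I_r => k (iter (nth (Ordinal n0) (farseq (far (val x))) i) T (val x))]).
(* Each far time contributes more than [L eps'] to a sum of at most [n eps']. *)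
have far_card x : (size (farseq (far x)) <= r)%N.
  have nL0 : 0 <= n%:R / L by rewrite divr_ge0// ltW.
  rewrite truncn_ge_nat// -cardE ler_pdivlMr// -(ler_pM2r e0) -mulrA.
  apply: (@le_trans _ _ (\sum_(t < n) mdist (iter t T x) (iter t T (val (f x))))).
    rewrite mulr_natl -sumr_const big_mkcond/=; apply: ler_sum => t _.
    by case: ifP => [|_]; [rewrite inE ffunE => /ltW|exact: mdist_ge0].
  by have := hf x; rewrite /davg ler_pdivrMl.
have inj : injective code.
  move=> x x' [ef efar ek].
  apply/val_inj; apply: contrapT => xx'.
  have := sE (val x) (val x') (valP x) (valP x') xx'; apply/negP; rewrite -leNgt.
  have eps0 : 0 <= eps.
    by apply: le_trans Le; rewrite mulrn_wge0// mulr_ge0// ltW.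
  apply: bigmax_le => // t _.
  have [tfar|tnear] := boolP (far (val x) t); last first.
    have tnear' : ~~ far (val x') t by rewrite -efar.
    move: tnear tnear'; rewrite !ffunE -!leNgt -ef => h1 h2.
    apply: le_trans Le; apply: le_trans (metric_triangle _ (iter t T (val (f (val x)))) _) _.
    by rewrite mulr2n [X in _ + X]metric_sym lerD.
  have ti : (index t (farseq (far (val x))) < r)%N.
    apply: leq_trans (far_card (val x)); rewrite index_mem mem_enum.
    exact: tfar.
  have := congr1 (fun g : {ffun 'I_r -> C} => g (Ordinal ti)) ek.
  rewrite !ffunE/= -efar nth_index ?mem_enum//.
  have h1 := hk (iter t T (val x)); have h2 := hk (iter t T (val x')).
  move=> ekt; rewrite -ekt in h2; apply: le_trans Le.
  apply: le_trans (metric_triangle _ (val (k (iter t T (val x)))) _) _.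
  rewrite metric_sym (@le_trans _ _ (eps' *+ 2))//.
    by rewrite mulr2n ltW// ltrD.
  by rewrite ler_pMn2r// ler_peMl// ltW.
have := leq_card code inj.
by rewrite !card_prod !card_ffun card_bool !card_ord -!cardfE.
Qed.

End Counting.

(** * Comparison of upper limits *)

Section LimsupComparison.
Variable R : realType.
Implicit Types (u v : nat -> \bar R).

Lemma limn_esup_ge u (a : \bar R) :
  (forall n, (0 < n)%N -> (a <= u n)%E) -> (a <= limn_esup u)%E.
Proof.
move=> au; apply: le_ereal_inf_tmp => _ [V [k _ kV] <-].
apply: (@le_trans _ _ (u k.+1)); first exact: au.
by apply: ereal_sup_ubound; exists k.+1 => //; apply: kV => /=.
Qed.

Lemma limn_esup_leD u v (c : R) :
  (forall n, (0 < n)%N -> (u n <= v n + c%:E)%E) ->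
  (limn_esup u <= limn_esup v + c%:E)%E.
Proof.
move=> uv; rewrite -leeBlDr//; apply: le_ereal_inf_tmp => _ [V [k _ kV] <-].
rewrite leeBlDr//.
apply: (@le_trans _ _ (ereal_sup (u @` [set n | (k.+1 <= n)%N]))).
  by apply: ereal_inf_lbound; exists [set n | (k.+1 <= n)%N] => //; exists k.+1.
apply: ge_ereal_sup => _ [n /= kn <-].
apply: (le_trans (uv n _)); first exact: leq_trans kn.
rewrite leeD2r//; apply: ereal_sup_ubound; exists n => //.
by apply: kV => /=; exact: ltnW.
Qed.

Lemma lee_of_lt_real (a c : \bar R) :
  (0 <= c)%E -> (forall s : R, (s%:E < a)%E -> (s%:E <= c)%E) -> (a <= c)%E.
Proof.
case: c => [r r0|_ _|//]; last exact: leey.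
move=> h; case: a h => [s h|h|h]; last exact: leNye.
- rewrite lee_fin; apply/ler_addgt0Pr => e e0.
  rewrite -lerBlDr -lee_fin; apply: h.
  by rewrite lte_fin ltrBlDr ltrDl.
- have := h (r + 1) (ltry _); rewrite lee_fin.
  by rewrite gerDl ler10.
Qed.

Lemma near_right0_ln_ge (K : R) : \forall e \near (0 : R)^'+, K <= `|ln e|.
Proof.
near=> e.
have e0 : 0 < e by near: e; exact: nbhs_right_gt.
have ek : e < expR (- `|K|) by near: e; apply: nbhs_right_lt; exact: expR_gt0.
have : ln e < - `|K| by rewrite -ltr_expR lnK.
move=> h; have := ler_norm K; have := ler_norm (- ln e); rewrite normrN; lra.
Unshelve. all: by end_near. Qed.

Lemma log_rate_ge0 (h : R -> \bar R) :
  (forall e, 0 < e -> (0 <= h e)%E) -> (0 <= log_rate h)%E.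
Proof.
move=> h0; apply: le_ereal_inf_tmp => _ [V FV <-].
have : \forall e \near (0 : R)^'+, V e /\ 0 < e /\ 1 <= `|ln e|.
  near=> e; split; first by near: e.
  split; first by near: e; exact: nbhs_right_gt.
  by near: e; exact: near_right0_ln_ge.
move=> /filter_ex[e [Ve [e0 le1]]].
apply: (@le_trans _ _ (h e / (`|ln e|)%:E)%E).
  have ln0 : 0 < `|ln e| by exact: lt_le_trans le1.
  by rewrite inver gt_eqF// mule_ge0 ?h0// lee_fin invr_ge0.
by apply: ereal_sup_ubound; exists e.
Unshelve. all: by end_near. Qed.

(** Additive constants disappear after division by [|ln eps|], and the factors
    [b], from the comparison and from the change of scale, tend to 1.
    Since [h] is nonnegative, the real bounds [M] above its rate are positive,
    so that [M |ln (u e)|] is at most [M b |ln e|]. *)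
Lemma log_rate_le (g h : R -> \bar R) :
  (forall e, 0 < e -> (0 <= h e)%E) ->
  (forall b : R, 1 < b -> exists (u : R -> R) (C : R),
     u e @[e --> (0 : R)^'+] --> (0 : R)^'+ /\
     \forall e \near (0 : R)^'+, `|ln (u e)| <= b * `|ln e| /\
       (g e <= b%:E * h (u e) + C%:E)%E) ->
  (log_rate g <= log_rate h)%E.
Proof.
move=> h0 cmp.
have l0 := log_rate_ge0 h0.
case El : (log_rate h) l0 => [l| |//] l0; last exact: leey.
rewrite lee_fin in l0.
apply/lee_addgt0Pr => k k0.
pose M := l + k / 3.
have M0 : 0 < M by rewrite /M; lra.
(* With [t <= 1] one has [(1 + t)^2 <= 1 + 3 t], so that [b * b * M] exceeds [M]
   by at most [k / 3]. *)
pose t := Num.min 1 (k / (9 * M)).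
have t0 : 0 < t by rewrite lt_min ltr01 divr_gt0// mulr_gt0.
have t1 : t <= 1 by rewrite ge_min lexx.
have tM : t * (9 * M) <= k.
  rewrite -ler_pdivlMr ?mulr_gt0//; rewrite ge_min lexx orbT//.
pose b := 1 + t.
have b1 : 1 < b by rewrite /b; lra.
have bM : b * b * M <= l + k / 3 * 2.
  have : t * t <= t by rewrite ler_piMl// ltW.
  rewrite /b => tt.
  have : t * t * M <= t * M by rewrite ler_wpM2r// ltW.
  rewrite /M in tM *; lra.
have [u [C [u0 uC]]] := cmp b b1.
have hM : \forall e \near (0 : R)^'+, (h e / (`|ln e|)%:E < M%:E)%E.
  have : (log_rate h < M%:E)%E by rewrite El lte_fin /M; lra.
  move=> /ereal_inf_lt[_ [V FV <-] supV].
  apply: filterS FV => e Ve; apply: le_lt_trans supV.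
  by apply: ereal_sup_ubound; exists e.
have huM : \forall e \near (0 : R)^'+, (h (u e) <= (M * `|ln (u e)|)%:E)%E.
  have : \forall e \near (0 : R)^'+, (h e <= (M * `|ln e|)%:E)%E.
    near=> e; have : (h e / (`|ln e|)%:E < M%:E)%E by near: e.
    have : 1 <= `|ln e| by near: e; exact: near_right0_ln_ge.
    move=> /(lt_le_trans ltr01) ln0.
    by rewrite inver gt_eqF// lte_pdivrMr// -EFinM => /ltW.
  exact: u0.
have : \forall e \near (0 : R)^'+, (g e / (`|ln e|)%:E <= (l + k)%:E)%E.
  near=> e.
  have ln1 : 1 <= `|ln e| by near: e; exact: near_right0_ln_ge.
  have lnC : 3 * C / k <= `|ln e| by near: e; exact: near_right0_ln_ge.
  have ln0 : 0 < `|ln e| by exact: lt_le_trans ln1.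
  have hu : (h (u e) <= (M * `|ln (u e)|)%:E)%E by near: e.
  have [lnu ge] : `|ln (u e)| <= b * `|ln e| /\
     (g e <= b%:E * h (u e) + C%:E)%E by near: e.
  rewrite inver gt_eqF// lee_pdivrMr// -EFinM.
  apply: (le_trans ge).
  apply: (@le_trans _ _ (b * (M * `|ln (u e)|) + C)%:E).
    rewrite [leRHS]EFinD leeD2r// [leRHS]EFinM lee_wpmul2l//.
    by rewrite lee_fin; lra.
  rewrite lee_fin.
  have b0 : 0 <= b by lra.
  have h1 : b * (M * `|ln (u e)|) <= b * (M * (b * `|ln e|)).
    by rewrite ler_wpM2l// ler_wpM2l// ltW.
  have h2 : b * b * M * `|ln e| <= (l + k / 3 * 2) * `|ln e|.
    by rewrite ler_wpM2r.
  have h3 : C <= k / 3 * `|ln e|.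
    by move: lnC; rewrite ler_pdivrMr//; lra.
  have -> : (l + k) * `|ln e| = (l + k / 3 * 2) * `|ln e| + k / 3 * `|ln e|.
    by field.
  apply: lerD => //; apply: le_trans h2; apply: le_trans h1 _.
  by rewrite le_eqVlt; apply/orP; left; apply/eqP; ring.
move=> gV; apply: (@le_trans _ _ (ereal_sup ((fun e : R => g e / (`|ln e|)%:E)%E @`
    [set e | (g e / (`|ln e|)%:E <= (l + k)%:E)%E]))).
  by apply: ereal_inf_lbound; exists [set e | (g e / (`|ln e|)%:E <= (l + k)%:E)%E].
by apply: ge_ereal_sup => _ [e /= ge <-].
Unshelve. all: by end_near. Qed.

End LimsupComparison.

(** * Comparison of the entropies at a fixed scale *)

Section EntropyComparison.
Variables (R : realType) (X : pointedMetricType R) (T : X -> X).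

Lemma max_separated_ge1 (rho : X -> X -> R) eps : (1 <= max_separated rho eps)%E.
Proof.
have := @max_separated_ge R X rho eps [fset point]%fset.
rewrite cardfs1; apply => x y; rewrite /= !inE => /eqP -> /eqP ->.
by move=> /(_ erefl).
Qed.

Lemma lne_max_separated_ge0 (rho : X -> X -> R) eps :
  (0 <= lne (max_separated rho eps))%E.
Proof. by rewrite lne_ge0 max_separated_ge1. Qed.

Lemma ediv_natr (a : \bar R) n : (0 < n)%N ->
  (a / (n%:R)%:E = a * (n%:R^-1)%:E)%E.
Proof. by move=> n0; rewrite inver gt_eqF// ltr0n. Qed.

Lemma sep_entropy_ge0 eps : (0 <= sep_entropy T eps)%E.
Proof.
apply: limn_esup_ge => n n0; rewrite ediv_natr//.
by rewrite mule_ge0 ?lne_max_separated_ge0// lee_fin invr_ge0.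
Qed.

Lemma avg_sep_entropy_ge0 eps : (0 <= avg_sep_entropy T eps)%E.
Proof.
apply: limn_esup_ge => n n0; rewrite ediv_natr//.
by rewrite mule_ge0 ?lne_max_separated_ge0// lee_fin invr_ge0.
Qed.

Lemma avg_sep_entropy_le_sep_entropy eps :
  (avg_sep_entropy T eps <= sep_entropy T eps)%E.
Proof.
rewrite -[leRHS]adde0; apply: limn_esup_leD => n n0.
rewrite adde0 !ediv_natr// lee_wpmul2r ?lee_fin ?invr_ge0//.
rewrite lee_lne ?in_itv/= ?leey ?max_separated_ge0//.
apply: ge_ereal_sup => _ [E sE <-]; apply: max_separated_ge.
move=> x y Ex Ey xy; exact: lt_le_trans (sE x y Ex Ey xy) (davg_le_dmax _ _ _ _).
Qed.

(** Either there are arbitrarily large separated sets, and the bounds below are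
    trivial, or there is a finite dense set of at most that cardinality. *)
Lemma lne_max_separatedP n eps : 0 <= eps ->
  (lne (max_separated (davg T n) eps) = +oo)%E \/
  exists F : {fset X}, [/\ (0 < #|` F|)%N,
    forall x, exists2 c, c \in F & davg T n x c <= eps &
    ((ln #|` F|%:R)%:E <= lne (max_separated (davg T n) eps))%E].
Proof.
move=> eps0; have [fin|] := ltP (max_separated (davg T n) eps) +oo%E; last first.
  by rewrite leye_eq => /eqP ->; left.
right; have [|x|F [F0 sF cF]] := exists_maximal_separated _ _ fin.
- by move=> x y; exact: davgC.
- by rewrite davgxx.
exists F; split => //; rewrite -lne_EFin ?ltr0n//.
rewrite lee_lne ?in_itv/= ?leey ?max_separated_ge0 ?lee_fin ?ler0n//.
exact: max_separated_ge.
Qed.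

Lemma sup_rate_distortion_le eps : continuous T -> 0 <= eps ->
  (sup_rate_distortion T eps <= avg_sep_entropy T eps)%E.
Proof.
move=> cT eps0; apply: ge_ereal_sup => _ [mu _ <-].
apply: limn_esup_ge => n n0; rewrite ediv_natr//.
have [->|[F [F0 cF lF]]] := lne_max_separatedP n eps0.
  by rewrite mulyr gtr0_sg ?mul1e ?leey// invr_gt0 ltr0n.
apply: (le_trans (rate_distortion_le_ln_card cT mu n0 cF)).
by rewrite mulrC EFinM lee_wpmul2r// lee_fin invr_ge0.
Qed.

Hypothesis cX : compact [set: X].

(** Compactness makes the set of cardinalities nonempty, so its infimum is a
    minimum. *)
Lemma covering_numberP eps : 0 < eps ->
  exists C : {fset X}, [/\ (0 < #|` C|)%N,
    forall x, exists2 c, c \in C & mdist c x < eps &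
    covering_number X eps = (#|` C|%:R)%:E].
Proof.
move=> eps0.
pose P k := `[< exists2 C : {fset X},
  forall x, exists2 c, c \in C & mdist c x < eps & #|` C| = k >].
have exP : exists k, P k.
  have [C hC] := finite_ball_cover cX (fun _ : X => eps0).
  by exists #|` C|; apply/asboolP; exists C.
case: (ex_minnP exP) => k /asboolP[C covC Ck] kmin.
exists C; split => //.
  by have [c cC _] := covC point; rewrite cardfs_gt0; apply/fset0Pn; exists c.
apply/eqP; rewrite eq_le; apply/andP; split.
  apply: ereal_inf_lbound; exists C => // x _.
  by have [c cC cx] := covC x; exists c => //=; rewrite ballEmdist.
apply: le_ereal_inf_tmp => _ [C' /= cov' <-]; rewrite lee_fin ler_nat Ck.
apply: kmin; apply/asboolP; exists C' => // x.
have [c /= cC' cx] := cov' x I; exists c => //.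
by move: cx; rewrite ballEmdist.
Qed.

Lemma sep_entropy_le_avg (eps eps' L c : R) :
  0 < eps' -> 1 <= L -> L * eps' *+ 2 <= eps ->
  ((L^-1)%:E * lne (covering_number X eps') <= c%:E)%E ->
  (sep_entropy T eps <= avg_sep_entropy T eps' + (ln 2 + c)%:E)%E.
Proof.
move=> e0 L1 Le hc; have [C [C0 covC EC]] := covering_numberP e0.
have L0 : 0 < L by exact: lt_le_trans L1.
move: hc; rewrite EC lne_EFin ?ltr0n// -EFinM lee_fin => hc.
apply: limn_esup_leD => n n0; rewrite !ediv_natr//.
have nR : 0 < n%:R :> R by rewrite ltr0n.
have [->|[F [F0 cF lF]]] := lne_max_separatedP n (ltW e0).
  by rewrite mulyr gtr0_sg ?invr_gt0// mul1e addye// leey.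
apply: (@le_trans _ _ (((ln #|` F|%:R + n%:R * (ln 2 + c)) * n%:R^-1)%:E)).
  rewrite EFinM lee_wpmul2r ?lee_fin ?invr_ge0//.
  apply: lne_max_separated_le => E E0 sE.
  have := card_dmax_separated_le n0 e0 L1 Le sE cF covC.
  rewrite -(ler_nat R) => hE.
  apply: (@le_trans _ _ (ln (#|` F| * 2 ^ n * #|` C| ^ Num.truncn (n%:R / L))%:R)).
    rewrite ler_ln ?posrE ?ltr0n//.
    by rewrite !muln_gt0 F0 !expn_gt0 C0.
  rewrite !natrM !natrX lnM ?posrE ?mulr_gt0 ?exprn_gt0 ?ltr0n//.
  rewrite lnM ?posrE ?exprn_gt0 ?ltr0n// !lnXn ?ltr0n//.
  rewrite -addrA lerD2l mulrDr [n%:R * ln 2]mulr_natl lerD2l.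
  have lnC : 0 <= ln (#|` C|%:R : R) by rewrite ln_ge0// ler1n.
  apply: (@le_trans _ _ (n%:R / L * ln #|` C|%:R)).
    rewrite -[ln _ *+ _]mulr_natl ler_wpM2r// truncn_le divr_ge0// ltW//.
  by rewrite -mulrA ler_wpM2l.
have -> : (ln #|` F|%:R + n%:R * (ln 2 + c)) * n%:R^-1 =
    ln #|` F|%:R * n%:R^-1 + (ln 2 + c) by field; rewrite gt_eqF.
by rewrite EFinD leeD2r// EFinM lee_wpmul2r// lee_fin invr_ge0.
Qed.

Hypothesis cT : continuous T.

(** A supremum over the invariant measures is nonnegative only because there is
    one; the lower bound with [theta = 0] provides it. *)
Lemma sup_rate_distortion_ge0 eps : 0 < eps -> (0 <= sup_rate_distortion T eps)%E.
Proof.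
move=> e0.
have [||||mu mu_inv h] := @exists_invariant_rate_ge R X T cX cT (eps * 3) eps 0 (-1).
- by rewrite mulr_gt0.
- by rewrite lexx ler01.
- by rewrite subr0; lra.
- apply: (lt_le_trans _ (avg_sep_entropy_ge0 _)).
  by rewrite lte_fin ltrN10.
rewrite mul0r in h; apply: (le_trans h).
by apply: ereal_sup_ubound; exists mu.
Qed.

(** The distortion level [eps / L] allows [theta = 1 / b] in the lower bound,
    since [2 / L < 1 - 1 / b]. *)
Lemma avg_sep_entropy_le_rate (eps b L : R) :
  0 < eps -> 1 < b -> 0 < L -> 2 * b < L * (b - 1) ->
  (avg_sep_entropy T eps <= b%:E * sup_rate_distortion T (eps / L))%E.
Proof.
move=> e0 b1 L0 bL; have b0 : 0 < b by exact: lt_trans b1.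
have eL : 0 < eps / L by exact: divr_gt0.
apply: lee_of_lt_real.
  by rewrite mule_ge0 ?sup_rate_distortion_ge0// lee_fin ltW.
move=> s hs.
have [|||//|mu mu_inv h] :=
  @exists_invariant_rate_ge R X T cX cT eps (eps / L) b^-1 s.
- by [].
- by rewrite invr_ge0 ltW//= invf_le1// ltW.
- rewrite -mulr_natr -(ltr_pM2r (mulr_gt0 b0 L0)).
  have -> : eps / L * 2 * (b * L) = eps * (2 * b) by field; rewrite gt_eqF.
  have -> : (1 - b^-1) * eps * (b * L) = eps * (L * (b - 1)).
    by field; rewrite gt_eqF.
  by rewrite ltr_pM2l.
have h' : ((b^-1 * s)%:E <= sup_rate_distortion T (eps / L))%E.
  by apply: (le_trans h); apply: ereal_sup_ubound; exists mu.
have -> : s%:E = (b%:E * (b^-1 * s)%:E)%E.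
  by rewrite -EFinM mulrA mulfV ?mul1r// gt_eqF.
by rewrite lee_wpmul2l// lee_fin ltW.
Qed.

End EntropyComparison.

(** * Comparison of the growth rates *)

Section Rates.
Variables (R : realType) (X : pointedMetricType R) (T : X -> X).
Hypotheses (cX : compact [set: X]) (cT : continuous T).

Lemma log_rate_le_pointwise (g h : R -> \bar R) :
  (forall e, 0 < e -> (0 <= h e)%E) -> (forall e, 0 < e -> (g e <= h e)%E) ->
  (log_rate g <= log_rate h)%E.
Proof.
move=> h0 gh; apply: log_rate_le => // b b1; exists id, 0; split.
  exact: cvg_id.
near=> e; have e0 : 0 < e by near: e; exact: nbhs_right_gt.
split; first by rewrite ler_peMl// ltW.
rewrite adde0; apply: (le_trans (gh e e0)).
by rewrite -[leLHS]mul1e lee_wpmul2r ?h0// lee_fin ltW.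
Unshelve. all: by end_near. Qed.

Lemma cvg_at_right0 (u : R -> R) :
  (forall e, 0 < e -> 0 < u e) ->
  (forall k, 0 < k -> \forall e \near (0 : R)^'+, u e < k) ->
  u e @[e --> (0 : R)^'+] --> (0 : R)^'+.
Proof.
move=> u0 uk V [k /= k0 kV].
have := uk k k0; rewrite /nbhs/=; move=> h.
near=> e; have e0 : 0 < e by near: e; exact: nbhs_right_gt.
apply: kV => /=; last exact: u0.
by rewrite sub0r normrN gtr0_norm ?u0//; near: e.
Unshelve. all: by end_near. Qed.

Lemma log_rate_avg_le : (log_rate (avg_sep_entropy T) <=
  log_rate (sup_rate_distortion T))%E.
Proof.
apply: log_rate_le => [e|b b1]; first exact: sup_rate_distortion_ge0.
pose L := 2 * b / (b - 1) + 1.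
have bb : 0 < b - 1 by rewrite subr_gt0.
have b0 : 0 < b by exact: lt_trans b1.
have L1 : 1 < L by rewrite ltrDr divr_gt0// mulr_gt0.
have L0 : 0 < L by exact: lt_trans L1.
have bL : 2 * b < L * (b - 1).
  by rewrite -ltr_pdivrMr// ltrDl.
exists (fun e => e / L), 0; split.
  apply: cvg_at_right0 => [e e0|k k0]; first exact: divr_gt0.
  by near=> e; rewrite ltr_pdivrMr//; near: e; apply: nbhs_right_lt; rewrite mulr_gt0.
near=> e; have e0 : 0 < e by near: e; exact: nbhs_right_gt.
split; last by rewrite adde0; exact: avg_sep_entropy_le_rate.
rewrite ln_div ?posrE//; apply: le_trans (ler_normB _ _) _.
have : `|ln L| / (b - 1) <= `|ln e| by near: e; exact: near_right0_ln_ge.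
by rewrite ler_pdivrMr//; lra.
Unshelve. all: by end_near. Qed.

(** With [u = (eps / 2) ^ c] and [L = u ^ - delta], where
    [c = 1 / (1 - delta)] is slightly larger than 1, the requirement
    [2 L u <= eps] is an equality, and tame growth bounds
    [(ln N(u)) / L = u ^ delta * ln N(u)] by 1. *)
Lemma upper_mdim_le_log_rate_avg : tame_growth X ->
  (upper_mdim T <= log_rate (avg_sep_entropy T))%E.
Proof.
move=> tame; apply: log_rate_le => [e _|b b1]; first exact: avg_sep_entropy_ge0.
pose c := (1 + b) / 2.
have c1 : 1 < c by rewrite /c; lra.
have cb : c < b by rewrite /c; lra.
have c0 : 0 < c by exact: lt_trans c1.
pose delta := 1 - c^-1.
have d0 : 0 < delta by rewrite subr_gt0 invf_lt1.
pose u (e : R) := (e / 2) `^ c.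
have u0 e : 0 < e -> 0 < u e by move=> e0; rewrite powR_gt0// divr_gt0.
have ucvg : u e @[e --> (0 : R)^'+] --> (0 : R)^'+.
  apply: cvg_at_right0 => // k k0; near=> e.
  have e0 : 0 < e by near: e; exact: nbhs_right_gt.
  have ek : e < k by near: e; exact: nbhs_right_lt.
  have e1 : e < 1 by near: e; apply: nbhs_right_lt.
  apply: le_lt_trans ek.
  apply: (@le_trans _ _ (e / 2)); last by lra.
  by apply: ge1r_powR; [apply/andP; split; lra|exact: ltW].
have tame1 : \forall e \near (0 : R)^'+,
    ((e `^ delta)%:E * lne (covering_number X e) <= 1%:E)%E.
  have [fin fcvg] := (fine_cvgP _ _).1 (tame delta d0).
  have lt1 := cvgr_lt _ fcvg _ ltr01.
  near=> e.
  have f1 : fine ((e `^ delta)%:E * lne (covering_number X e))%E < 1.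
    near: e; exact: lt1.
  have fn : ((e `^ delta)%:E * lne (covering_number X e))%E \is a fin_num.
    near: e; exact: fin.
  by rewrite -(fineK fn) lee_fin ltW.
exists u, (ln 2 + 1); split => //.
have tameu : \forall e \near (0 : R)^'+,
    (((u e) `^ delta)%:E * lne (covering_number X (u e)) <= 1%:E)%E.
  exact: (ucvg _ tame1).
near=> e; have e0 : 0 < e by near: e; exact: nbhs_right_gt.
have e1 : e < 1 by near: e; apply: nbhs_right_lt.
have u1 : u e < 1.
  near: e; exact: (ucvg _ (nbhs_right_lt ltr01)).
have e20 : 0 < e / 2 by exact: divr_gt0.
split.
  rewrite /u ln_powR normrM gtr0_norm// ln_div ?posrE//.
  have : c * `|ln 2| / (b - c) <= `|ln e| by near: e; exact: near_right0_ln_ge.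
  rewrite ler_pdivrMr ?subr_gt0// => h.
  apply: (@le_trans _ _ (c * (`|ln e| + `|ln 2|))).
    by rewrite ler_wpM2l ?ler_normB// ltW.
  by rewrite mulrDr; lra.
apply: (@le_trans _ _ (avg_sep_entropy T (u e) + (ln 2 + 1)%:E)%E); last first.
  rewrite leeD2r// -[leLHS]mul1e lee_wpmul2r ?avg_sep_entropy_ge0// lee_fin ltW//.
apply: (@sep_entropy_le_avg _ _ T cX e (u e) (u e `^ (- delta)) 1).
- exact: u0.
- rewrite -[leLHS](powRr0 (u e)); apply: ger_powR; last by rewrite oppr_le0 ltW.
  by rewrite u0//= ltW.
- rewrite -[X in _ * X](powRr1 (ltW (u0 _ e0))) -powRD; last first.
    by apply/implyP => _; rewrite gt_eqF// u0.
  rewrite (_ : - delta + 1 = c^-1); last by rewrite /delta; ring.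
  rewrite /u -powRrM mulfV ?gt_eqF// powRr1; last exact: ltW.
  by lra.
- by rewrite powRN invrK; near: e; exact: tameu.
Unshelve. all: by end_near. Qed.

End Rates.

Theorem proposition7 (R : realType) (X : pointedMetricType R) (T : X -> X) :
  compact [set: X] -> continuous T ->
  log_rate (sup_rate_distortion T) = log_rate (avg_sep_entropy T) /\
  (tame_growth X -> upper_mdim T = log_rate (sup_rate_distortion T)).
Proof.
move=> cX cT.
have le1 : (log_rate (sup_rate_distortion T) <= log_rate (avg_sep_entropy T))%E.
  apply: log_rate_le_pointwise => e e0; first exact: avg_sep_entropy_ge0.
  by apply: sup_rate_distortion_le => //; exact: ltW.
have le2 := log_rate_avg_le cX cT.
have eq1 : log_rate (sup_rate_distortion T) = log_rate (avg_sep_entropy T).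
  by apply/eqP; rewrite eq_le le1 le2.
split; [exact: eq1|move=> tame]; rewrite eq1.
apply/eqP; rewrite eq_le; apply/andP; split.
  exact: upper_mdim_le_log_rate_avg.
apply: log_rate_le_pointwise => e _; first exact: sep_entropy_ge0.
exact: avg_sep_entropy_le_sep_entropy.
Qed.
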